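(* Let $\Lambda$ be an Auslander algebra (finite dimensional over an algebraically closed field $k$). Then $\Lambda$ is left glued or right glued if and only if $\Lambda$ is representation-finite.
   Context: All algebras are finite dimensional over an algebraically closed field $k$; modules are finitely generated right modules; $\operatorname{pd}_\Lambda M$ and $\operatorname{id}_\Lambda M$ are the projective and injective dimensions of $M$ in $\operatorname{mod}\Lambda$. Auslander algebra: if $B$ is an algebra of finite representation type and $M_1,\dots,M_n$ is a complete set of representatives of the isomorphism classes of indecomposable $B$-modules, then $\operatorname{End}_B(\bigoplus_{i=1}^n M_i)$ is the Auslander algebra of $B$. An algebra is called an Auslander algebra if it arises in this way, up to Morita equivalence; by Auslander's characterization these are exactly the algebras $\Lambda$ with global dimension at most $2$ and dominant dimension at least $2$. Here, if $0\to\Lambda_\Lambda\to I_0\to I_1\to I_2\to\cdots$ is a minimal injective resolution, the dominant dimension of $\Lambda$ is $n$ if $I_i$ is projective for $0\le i\le n-1$ and $I_n$ is not projective, and is $\infty$ if all $I_n$ are projective. Left/right glued (homological characterization due to Assem and Coelho, taken here as the definition): $\Lambda$ is left glued if and only if $\operatorname{id}_\Lambda M=1$ for almost all (i.e. all but finitely many) non-isomorphic indecomposable $\Lambda$-modules $M$; $\Lambda$ is right glued if and only if $\operatorname{pd}_\Lambda M=1$ for almost all non-isomorphic indecomposable $\Lambda$-modules $M$. $\Lambda$ is representation-finite if there are only finitely many isomorphism classes of indecomposable $\Lambda$-modules. *)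

(* Defs.v *)
From HB Require Import structures.
From mathcomp Require Import all_boot all_order all_algebra all_field.

Set Implicit Arguments.
Unset Strict Implicit.
Unset Printing Implicit Defensive.

Import GRing.Theory.
Local Open Scope ring_scope.

(* Right A-modules on finite dimensional k-spaces. As A is finite dimensional,
   these are exactly the finitely generated right A-modules, each with the
   k-structure induced by k -> A. *)
Record rmod (k : fieldType) (A : falgType k) := RMod {
  rmod_car :> vectType k;
  ract : rmod_car -> A -> rmod_car;
  ractDl : forall x y a, ract (x + y) a = ract x a + ract y a;
  ractDr : forall x a b, ract x (a + b) = ract x a + ract x b;
  ractZl : forall (c : k) x a, ract (c *: x) a = c *: ract x a;
  ractZr : forall (c : k) x a, ract x (c *: a) = c *: ract x a;
  ract1 : forall x, ract x 1 = x;
  ractM : forall x a b, ract x (a * b) = ract (ract x a) b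
}.

Section Modules.
Variables (k : fieldType) (A : falgType k).
Implicit Types (L M N : rmod A).

Definition is_rhom M N (f : 'Hom(M, N)) : Prop :=
  forall x a, f (ract x a) = ract (f x) a.

Definition rhom_surjective M N (f : 'Hom(M, N)) : Prop := limg f = fullv.

Definition is_riso M N (f : 'Hom(M, N)) : Prop :=
  [/\ is_rhom f, lker f = 0%VS & rhom_surjective f].

Definition isomorphic M N : Prop := exists f : 'Hom(M, N), is_riso f.

Definition is_zero M : Prop := \dim {:M} = 0%N.

Definition is_submod M (U : {vspace M}) : Prop :=
  forall x a, x \in U -> ract x a \in U.

Definition indecomposable M : Prop :=
  ~ is_zero M /\
  forall U V : {vspace M}, is_submod U -> is_submod V ->
    (U + V)%VS = fullv -> (U :&: V)%VS = 0%VS -> U = 0%VS \/ V = 0%VS.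

Definition projective_rmod M : Prop :=
  forall (X Y : rmod A) (p : 'Hom(X, Y)) (g : 'Hom(M, Y)),
    is_rhom p -> rhom_surjective p -> is_rhom g ->
    exists h : 'Hom(M, X), is_rhom h /\ (p \o h)%VF = g.

Definition injective_rmod M : Prop :=
  forall (X Y : rmod A) (i : 'Hom(X, Y)) (g : 'Hom(X, M)),
    is_rhom i -> lker i = 0%VS -> is_rhom g ->
    exists h : 'Hom(Y, M), is_rhom h /\ (h \o i)%VF = g.

(* ... -> P 2 -> P 1 -> P 0 -> M -> 0 *)
Record proj_resolution M (P : nat -> rmod A)
    (d : forall i, 'Hom(P i.+1, P i)) (e : 'Hom(P 0%N, M)) : Prop := {
  pres_proj : forall i, projective_rmod (P i);
  pres_dhom : forall i, is_rhom (d i);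
  pres_ehom : is_rhom e;
  pres_surj : rhom_surjective e;
  pres_exact0 : limg (d 0%N) = lker e;
  pres_exact : forall i, limg (d i.+1) = lker (d i)
}.

(* 0 -> M -> I 0 -> I 1 -> I 2 -> ... *)
Record inj_resolution M (I : nat -> rmod A)
    (d : forall i, 'Hom(I i, I i.+1)) (e : 'Hom(M, I 0%N)) : Prop := {
  ires_inj : forall i, injective_rmod (I i);
  ires_dhom : forall i, is_rhom (d i);
  ires_ehom : is_rhom e;
  ires_mono : lker e = 0%VS;
  ires_exact0 : limg e = lker (d 0%N);
  ires_exact : forall i, limg (d i) = lker (d i.+1)
}.

Definition pd_le M (n : nat) : Prop :=
  exists P d e, @proj_resolution M P d e /\ forall i, (n < i)%N -> is_zero (P i).

Definition id_le M (n : nat) : Prop :=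
  exists I d e, @inj_resolution M I d e /\ forall i, (n < i)%N -> is_zero (I i).

(* pd M = n, resp. id M = n; no n qualifies when the dimension is infinite. *)
Definition pd_eq M (n : nat) : Prop :=
  pd_le M n /\ forall m, pd_le M m -> (n <= m)%N.

Definition id_eq M (n : nat) : Prop :=
  id_le M n /\ forall m, id_le M m -> (n <= m)%N.

Definition finitely_many_up_to_iso (P : rmod A -> Prop) : Prop :=
  exists (n : nat) (E : 'I_n -> rmod A),
    forall X, P X -> exists i, isomorphic X (E i).

Definition almost_all_indecomposables (P : rmod A -> Prop) : Prop :=
  finitely_many_up_to_iso (fun X => indecomposable X /\ ~ P X).

Definition complete_indecomposables (n : nat) (M : 'I_n -> rmod A) : Prop :=
  [/\ forall i, indecomposable (M i),
      forall i j, isomorphic (M i) (M j) -> i = j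
    & forall X, indecomposable X -> exists i, isomorphic X (M i)].

Definition rmod0 : rmod A.
Proof.
by apply: (@RMod _ _ 'rV[k]_0 (fun x _ => x)) => *;
  rewrite [LHS]thinmx0 [RHS]thinmx0.
Defined.

Definition dsum_act M N (x : M * N) (a : A) : M * N :=
  (ract x.1 a, ract x.2 a).

Definition dsum M N : rmod A.
Proof.
exists (M * N)%type (@dsum_act M N); rewrite /dsum_act.
- by move=> x y a; rewrite /= !ractDl.
- by move=> x a b; rewrite !ractDr.
- by move=> c x a; rewrite /= !ractZl.
- by move=> c x a; rewrite !ractZr.
- by case=> x y; rewrite /= !ract1.
- by move=> x a b; rewrite !ractM.
Defined.

Definition bigdsum (n : nat) (M : 'I_n -> rmod A) : rmod A :=
  \big[dsum/rmod0]_(i < n) M i.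

(* C is isomorphic, as a k-algebra, to End_A(M) with product the composition
   of maps (f g)(x) = f (g x). *)
Definition is_end_algebra (C : falgType k) M : Prop :=
  exists phi : 'Hom(C, 'End(M)),
    [/\ lker phi = 0%VS,
        forall f : 'End(M), is_rhom f <-> f \in limg phi,
        phi 1 = \1%VF
      & forall a b, phi (a * b) = (phi a \o phi b)%VF].

Definition rep_finite : Prop := finitely_many_up_to_iso indecomposable.

Definition left_glued : Prop :=
  almost_all_indecomposables (fun X => id_eq X 1).

Definition right_glued : Prop :=
  almost_all_indecomposables (fun X => pd_eq X 1).

End Modules.

(* k-linear functors mod A -> mod B. The value of fmap on linear maps that are
   not module homomorphisms is irrelevant. *)
Record rfunctor (k : fieldType) (A B : falgType k) := RFunctor {
  fobj :> rmod A -> rmod B;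
  fmap : forall M N : rmod A, 'Hom(M, N) -> 'Hom(fobj M, fobj N);
  fmap_hom : forall (M N : rmod A) (f : 'Hom(M, N)), is_rhom f -> is_rhom (fmap f);
  fmap_linear : forall (M N : rmod A) (c : k) (f g : 'Hom(M, N)),
    is_rhom f -> is_rhom g -> fmap (c *: f + g) = c *: fmap f + fmap g;
  fmap_id : forall M : rmod A, @fmap M M \1%VF = \1%VF;
  fmap_comp : forall (L M N : rmod A) (g : 'Hom(M, N)) (f : 'Hom(L, M)),
    is_rhom f -> is_rhom g -> fmap (g \o f)%VF = (fmap g \o fmap f)%VF
}.

Definition comp_natiso_id (k : fieldType) (A B : falgType k)
    (F : rfunctor A B) (G : rfunctor B A) : Prop :=
  exists eta : forall M : rmod A, 'Hom(M, G (F M)),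
    (forall M, is_riso (eta M)) /\
    forall (M N : rmod A) (f : 'Hom(M, N)), is_rhom f ->
      (eta N \o f)%VF = (fmap G (fmap F f) \o eta M)%VF.

Definition morita_equivalent (k : fieldType) (A B : falgType k) : Prop :=
  exists (F : rfunctor A B) (G : rfunctor B A),
    comp_natiso_id F G /\ comp_natiso_id G F.

(* C is the Auslander algebra of B; the existence of a finite complete family
   of indecomposables expresses that B is of finite representation type. *)
Definition auslander_algebra_of (k : fieldType) (B C : falgType k) : Prop :=
  exists (n : nat) (M : 'I_n -> rmod B),
    complete_indecomposables M /\ is_end_algebra C (bigdsum M).

Definition is_auslander_algebra (k : fieldType) (A : falgType k) : Prop :=
  exists B C : falgType k, auslander_algebra_of B C /\ morita_equivalent A C.

(* Main.v *)
Require Import Defs.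
From HB Require Import structures.
From mathcomp Require Import all_boot all_order all_algebra all_field.
From Stdlib Require Import Classical IndefiniteDescription.

(** A representation-finite algebra is left glued and right glued, as finitely
    many indecomposable modules leave finitely many exceptions.

    For the converse, let C = End_B(M) with M the direct sum of the
    indecomposable B-modules, and let C be right glued. Every B-module is a
    direct summand of a power of M, so Hom(M, -) is an equivalence from the
    B-modules to the projective C-modules ([hom_map_inj], [hom_map_full],
    [projective_hom_rmod]). A C-module N of projective dimension 1 therefore
    has a resolution 0 -> Hom(M, X) -> Hom(M, Y) -> N -> 0 with X a submodule of
    Y, and left exactness of Hom(M, -) embeds N in the projective module
    Hom(M, Y / X). So N is a syzygy of F = coker (Hom(M, Y) -> Hom(M, Y / X)),
    and no nonzero direct summand of F has projective dimension at most 1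
    ([embed_in_projective]). The indecomposable direct summands of F thus belong
    to the finite list of modules E i whose projective dimension is not 1.
    Comparing the embedding of N with surjections from projective modules onto the
    E i, and using that N has a local endomorphism ring, N is seen to be a direct
    summand of the kernel K i of one of them. These are finitely many, each with
    finitely many indecomposable direct summands ([finitely_many_summands]), so
    there are finitely many N ([glued_rep_finite]).

    The remaining reductions are formal. Being right glued and being
    representation-finite can be expressed in the category of modules, and pass
    along equivalences ([equivalence_right_glued], [equivalence_rep_finite]);
    this replaces a Morita equivalent algebra by C. An algebra is left glued when
    the opposite of its module category is right glued. For C that opposite is,
    by transposition, the category of modules over the opposite algebra
    ([duality]), which is the endomorphism algebra of the dual of M. As the dual
    of M is again an additive generator, the argument above applies to it. *)

Set Implicit Arguments.
Unset Strict Implicit.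
Unset Printing Implicit Defensive.

Import GRing.Theory.
Local Open Scope ring_scope.

(** * Homomorphisms of modules *)

Section Actions.
Variables (k : fieldType) (A : falgType k).
Implicit Types (X Y Z : rmod A) (a b : A).

Definition ractr X a (x : X) : X := ract x a.

Fact ractr_is_linear X a : linear (@ractr X a).
Proof. by move=> c x y; rewrite /ractr ractDl ractZl. Qed.

HB.instance Definition _ X a := GRing.isLinear.Build k X X *:%R (@ractr X a)
  (@ractr_is_linear X a).

Definition ract_lfun X a : 'End(X) := linfun (@ractr X a).

Lemma ract_lfunE X a (x : X) : ract_lfun X a x = ract x a.
Proof. by rewrite lfunE. Qed.

Lemma ract0 X a : ract (0 : X) a = 0.
Proof. exact: (linear0 (@ractr X a)). Qed.

Lemma ract0r X (x : X) : ract x (0 : A) = 0.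
Proof. by rewrite -(scale0r (0 : A)) ractZr scale0r. Qed.

Lemma ract_sum X a (I : Type) (r : seq I) (P : pred I) (x : I -> X) :
  ract (\sum_(i <- r | P i) x i) a = \sum_(i <- r | P i) ract (x i) a.
Proof. exact: (linear_sum (@ractr X a)). Qed.

Lemma ract_sumr X (x : X) (I : Type) (r : seq I) (P : pred I) (a : I -> A) :
  ract x (\sum_(i <- r | P i) a i) = \sum_(i <- r | P i) ract x (a i).
Proof.
by apply: (big_morph (ract x)) => [b c|]; rewrite ?ractDr ?ract0r.
Qed.

Definition commutator_lfun X Y a (f : 'Hom(X, Y)) : 'Hom(X, Y) :=
  (f \o ract_lfun X a)%VF - (ract_lfun Y a \o f)%VF.

Fact commutator_lfun_is_linear X Y a : linear (@commutator_lfun X Y a).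
Proof.
move=> c f g; apply/lfunP => x.
rewrite /commutator_lfun !(scale_lfunE, add_lfunE, opp_lfunE, comp_lfunE, ract_lfunE).
by rewrite ractDl ractZl scalerDr scalerN opprD addrACA.
Qed.

HB.instance Definition _ X Y a := GRing.isLinear.Build k 'Hom(X, Y) 'Hom(X, Y) *:%R
  (@commutator_lfun X Y a) (@commutator_lfun_is_linear X Y a).

(** It is enough to commute with the action of a basis of the algebra; this is
    what makes the homomorphisms a subspace that can be written down. *)
Definition rhomv X Y : {vspace 'Hom(X, Y)} :=
  (\bigcap_(i < \dim {:A}) lker (linfun (@commutator_lfun X Y (vbasis {:A})`_i)))%VS.

Lemma rhomvP X Y (f : 'Hom(X, Y)) : f \in rhomv X Y <-> is_rhom f.
Proof.
split=> [/subv_bigcapP/= Hf x a | Hf].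
  have Hi i : f (ract x (vbasis {:A})`_i) = ract (f x) (vbasis {:A})`_i.
    case: (ltnP i (\dim {:A})) => [lt_i | ge_i]; last first.
      by rewrite nth_default ?size_tuple// !ract0r linear0.
    have := Hf (Ordinal lt_i) isT; rewrite -memvE memv_ker lfunE /=.
    move=> /eqP/lfunP/(_ x); rewrite /commutator_lfun.
    rewrite zero_lfunE !(add_lfunE, opp_lfunE, comp_lfunE, ract_lfunE) => /eqP.
    by rewrite subr_eq0 => /eqP.
  rewrite (coord_vbasis (memvf a)) !ract_sumr linear_sum.
  by apply: eq_bigr => i _; rewrite !ractZr linearZ; congr (_ *: _); apply: Hi.
apply/subv_bigcapP => i _; rewrite -memvE memv_ker lfunE /=; apply/eqP/lfunP => x.
rewrite zero_lfunE /commutator_lfun !(add_lfunE, opp_lfunE, comp_lfunE, ract_lfunE).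
by rewrite Hf subrr.
Qed.

Record rhom X Y : predArgType :=
  Rhom { rhom_lfun :> 'Hom(X, Y); rhom_lfunP : rhom_lfun \in rhomv X Y }.

Section HomSpace.
Variables X Y : rmod A.

HB.instance Definition _ := [isSub of rhom X Y for @rhom_lfun X Y].
HB.instance Definition _ := [Choice of rhom X Y by <:].
HB.instance Definition _ := [SubChoice_isSubZmodule of rhom X Y by <:].
HB.instance Definition _ := [SubZmodule_isSubLmodule of rhom X Y by <:].

Fact rhom_vect_axiom : Vector.axiom (\dim (rhomv X Y)) (rhom X Y).
Proof.
have [r r_lin r_bij] := @subvs_vect_iso _ _ (rhomv X Y).
exists (fun f : rhom X Y => r (Subvs (rhom_lfunP f))) => [c f g|].
  by rewrite -r_lin; congr (r _); apply: val_inj.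
have [r' rK r'K] := r_bij; exists (fun v => Rhom (subvsP (r' v))) => [f | v]; first by apply: val_inj; rewrite /= rK.
by rewrite -[RHS]r'K; congr (r _); apply: val_inj.
Qed.

HB.instance Definition _ := Lmodule_hasFinDim.Build k (rhom X Y) rhom_vect_axiom.

End HomSpace.

Lemma rhomM X Y (f : rhom X Y) x a : f (ract x a) = ract (f x) a.
Proof. by have [+ _] := rhomvP f; apply; apply: rhom_lfunP. Qed.

Lemma rhomP X Y (f g : rhom X Y) : (forall x, f x = g x) -> f = g.
Proof. by move=> fg; apply/val_inj/lfunP. Qed.

Definition mk_rhom X Y (f : 'Hom(X, Y)) (Hf : is_rhom f) : rhom X Y :=
  Rhom (proj2 (rhomvP f) Hf).

Lemma mk_rhomE X Y (f : 'Hom(X, Y)) (Hf : is_rhom f) : mk_rhom Hf = f :> 'Hom(X, Y).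
Proof. by []. Qed.

Lemma is_rhom_rhom X Y (f : rhom X Y) : is_rhom f.
Proof. exact: rhomM. Qed.

Lemma rhom_ofP X Y (f : X -> Y) : linear f ->
    (forall x a, f (ract x a) = ract (f x) a) ->
  {g : rhom X Y | forall x, g x = f x}.
Proof.
move=> lin_f Hf; pose fL := GRing.isLinear.Build k X Y *:%R f lin_f.
pose f' : {linear X -> Y} := HB.pack f fL.
have Hf' : is_rhom (linfun f') by move=> x a; rewrite !lfunE /=.
by exists (mk_rhom Hf') => x; rewrite mk_rhomE lfunE.
Qed.

Fact is_rhom_id X : is_rhom (\1%VF : 'Hom(X, X)).
Proof. by move=> x a; rewrite !id_lfunE. Qed.

Definition rid X : rhom X X := mk_rhom (@is_rhom_id X).

Fact is_rhom_comp X Y Z (g : rhom Y Z) (f : rhom X Y) : is_rhom (g \o f)%VF.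
Proof. by move=> x a; rewrite !comp_lfunE !rhomM. Qed.

Definition rcomp X Y Z (g : rhom Y Z) (f : rhom X Y) : rhom X Z :=
  mk_rhom (is_rhom_comp g f).

End Actions.

Arguments rid : simpl never.
Arguments rcomp : simpl never.

Infix "\*" := rcomp (at level 40, left associativity) : ring_scope.

Section HomTheory.
Variables (k : fieldType) (A : falgType k).
Implicit Types (W X Y Z : rmod A).

Lemma ridE X (x : X) : rid X x = x.
Proof. by rewrite mk_rhomE id_lfunE. Qed.

Lemma rcompE X Y Z (g : rhom Y Z) (f : rhom X Y) x : (g \* f) x = g (f x).
Proof. by rewrite mk_rhomE comp_lfunE. Qed.

Lemma rhom0E X Y x : (0 : rhom X Y) x = 0.
Proof. exact: zero_lfunE. Qed.

Lemma rhomDE X Y (f g : rhom X Y) x : (f + g) x = f x + g x.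
Proof. exact: add_lfunE. Qed.

Lemma rhomNE X Y (f : rhom X Y) x : (- f) x = - f x.
Proof. exact: opp_lfunE. Qed.

Lemma rhomZE X Y c (f : rhom X Y) x : (c *: f) x = c *: f x.
Proof. exact: scale_lfunE. Qed.

Definition rhomE := (ridE, rcompE, rhom0E, rhomDE, rhomNE, rhomZE).

Lemma rcompA W X Y Z (h : rhom Y Z) (g : rhom X Y) (f : rhom W X) :
  h \* (g \* f) = h \* g \* f.
Proof. by apply: rhomP => x; rewrite !rhomE. Qed.

Lemma rcomp1 X Y (f : rhom X Y) : f \* rid X = f.
Proof. by apply: rhomP => x; rewrite !rhomE. Qed.

Lemma rcomp1l X Y (f : rhom X Y) : rid Y \* f = f.
Proof. by apply: rhomP => x; rewrite !rhomE. Qed.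

Lemma rcomp0 X Y Z (f : rhom Y Z) : f \* (0 : rhom X Y) = 0.
Proof. by apply: rhomP => x; rewrite !rhomE linear0. Qed.

Lemma rcomp0l X Y Z (f : rhom X Y) : (0 : rhom Y Z) \* f = 0.
Proof. by apply: rhomP => x; rewrite !rhomE. Qed.

Lemma rcompDl X Y Z (g h : rhom Y Z) (f : rhom X Y) :
  (g + h) \* f = g \* f + h \* f.
Proof. by apply: rhomP => x; rewrite !rhomE. Qed.

Lemma rcompDr X Y Z (f : rhom Y Z) (g h : rhom X Y) :
  f \* (g + h) = f \* g + f \* h.
Proof. by apply: rhomP => x; rewrite !rhomE linearD. Qed.

Lemma rcompNl X Y Z (g : rhom Y Z) (f : rhom X Y) : (- g) \* f = - (g \* f).
Proof. by apply: rhomP => x; rewrite !rhomE. Qed.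

Lemma rcompNr X Y Z (g : rhom Y Z) (f : rhom X Y) : g \* (- f) = - (g \* f).
Proof. by apply: rhomP => x; rewrite !rhomE linearN. Qed.

Lemma rcomp_suml X Y Z (I : Type) (r : seq I) (P : pred I)
    (g : I -> rhom Y Z) (f : rhom X Y) :
  (\sum_(i <- r | P i) g i) \* f = \sum_(i <- r | P i) (g i \* f).
Proof.
by apply: (big_morph (fun h => h \* f)) => [g1 g2|]; rewrite ?rcompDl ?rcomp0l.
Qed.

Lemma rcomp_sumr X Y Z (I : Type) (r : seq I) (P : pred I)
    (g : I -> rhom X Y) (f : rhom Y Z) :
  f \* (\sum_(i <- r | P i) g i) = \sum_(i <- r | P i) (f \* g i).
Proof.
by apply: (big_morph (fun h => f \* h)) => [g1 g2|]; rewrite ?rcompDr ?rcomp0.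
Qed.

(** * Submodules, kernels and cokernels *)

Section Submodule.
Variables (X : rmod A) (U : {vspace X}) (subU : is_submod U).

Definition sub_act (u : subvs_of U) (a : A) : subvs_of U :=
  Subvs (subU a (subvsP u)).

Definition sub_rmod : rmod A.
Proof.
exists (subvs_of U) sub_act => *; apply: val_inj => /=.
- by rewrite ractDl.
- by rewrite ractDr.
- by rewrite ractZl.
- by rewrite ractZr.
- by rewrite ract1.
- by rewrite ractM.
Defined.

Lemma sub_inclP : exists i : rhom sub_rmod X,
  injective i /\ forall x, x \in U <-> exists u, x = i u.
Proof.
have [||i iE] := @rhom_ofP _ _ sub_rmod X (fun u => vsval u) => //.
exists i; split=> [u v | x]; first by rewrite !iE => /subvs_inj.
split=> [xU | [u ->]]; last by rewrite iE subvsP.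
by exists (Subvs xU); rewrite iE.
Qed.

(** The quotient is carried by a complement of the submodule, where an element
    acts by projecting its result back to that complement. *)
Lemma quot_projP : exists (Q : rmod A) (p : rhom X Q),
  (forall y, exists x, y = p x) /\ forall x, p x = 0 <-> x \in U.
Proof.
pose pr : X -> subvs_of U^C := vsproj U^C \o daddv_pi U^C U.
have prK (u : subvs_of U^C) : pr (vsval u) = u.
  by rewrite /pr /= daddv_pi_id ?subvsP ?vsvalK// capvC capv_compl.
have capC : (U^C :&: U = 0)%VS by rewrite capvC capv_compl.
have prD x y : pr (x + y) = pr x + pr y by rewrite /pr /= !linearD.
have prZ c x : pr (c *: x) = c *: pr x by rewrite /pr /= !linearZ.
have pr0 x : (pr x = 0) <-> x \in U.
  split=> [/(congr1 val) | xU].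
    rewrite /pr /= vsprojK ?memv_pi//= => pix0.
    have := daddv_pi_add (U := U^C) (V := U) (w := x) capC.
    by rewrite addvC addv_complf memvf pix0 add0r => /(_ isT) <-; apply: memv_pi.
  apply: val_inj; rewrite /pr /= vsprojK ?memv_pi//=.
  have := daddv_pi_add (U := U^C) (V := U) (w := x) capC.
  rewrite addvC addv_complf memvf => /(_ isT).
  by rewrite [X in _ + X]daddv_pi_id ?capv_compl// => /(canRL (addrK _)); rewrite subrr.
have prB x y : pr x = pr y -> x - y \in U.
  move=> e; apply/pr0; rewrite prD -(scaleN1r y) prZ e scaleN1r subrr //.
have pr_eq x y : x - y \in U -> pr x = pr y.
  move=> /pr0 /eqP; rewrite prD -(scaleN1r y) prZ scaleN1r subr_eq0 => /eqP //.
have prval x : vsval (pr x) - x \in U by apply: prB; rewrite prK.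
pose act (u : subvs_of U^C) (a : A) := pr (ract (vsval u) a).
have actE x a : act (pr x) a = pr (ract x a).
  apply: pr_eq; rewrite -[in - _](scaleN1r (ract x a)) -ractZl -ractDl scaleN1r.
  exact/subU/prval.
have Q : {Q : rmod A & {f : Q -> subvs_of U^C & {g : subvs_of U^C -> Q |
     [/\ linear g, cancel f g, cancel g f & forall x a, ract (g x) a = g (act x a)]}}}.
  unshelve eexists (@RMod _ _ (subvs_of U^C) act _ _ _ _ _ _).
  - by move=> x y a; rewrite /act linearD /= ractDl prD.
  - by move=> x a b; rewrite /act ractDr prD.
  - by move=> c x a; rewrite /act linearZ /= ractZl prZ.
  - by move=> c x a; rewrite /act ractZr prZ.
  - by move=> x; rewrite /act ract1 prK.
  - by move=> x a b; rewrite {1}/act ractM -actE.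
  by exists id, id.
case: Q => Q [f [g [lin_g fK gK Hg]]].
have [|x a|p pE] := @rhom_ofP _ _ X Q (g \o pr).
- by move=> c x y; rewrite /= prD prZ lin_g.
- by rewrite /= Hg actE.
exists Q, p; split=> [y | x].
  by exists (vsval (f y)); rewrite pE /= prK fK.
have g0 : g 0 = 0 by have := lin_g (-1) 0 0; rewrite scaler0 addr0 scaleN1r addNr.
by rewrite pE /= -pr0; split=> [e | -> //]; rewrite -[pr x]gK e -g0 gK.
Qed.

End Submodule.
End HomTheory.

(** * Gluedness in a category with zero morphisms *)

(** Both sides of the equivalence to be proved depend on the category of modules
    alone. Stating them in a category turns left gluedness into right gluedness
    of the opposite category and makes invariance under Morita equivalence and
    under duality two instances of one lemma. The zero morphisms serve to speak
    of kernels and of zero objects. *)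
Record zcat := ZCat {
  ob :> Type;
  mor : ob -> ob -> Type;
  idm : forall X, mor X X;
  cmp : forall X Y Z, mor Y Z -> mor X Y -> mor X Z;
  zer : forall X Y, mor X Y;
  cmpA : forall W X Y Z (h : mor Y Z) (g : mor X Y) (f : mor W X),
    cmp h (cmp g f) = cmp (cmp h g) f;
  cmp1l : forall X Y (f : mor X Y), cmp (idm Y) f = f;
  cmp1r : forall X Y (f : mor X Y), cmp f (idm X) = f;
  cmp0l : forall X Y Z (f : mor X Y), cmp (zer Y Z) f = zer X Z;
  cmp0r : forall X Y Z (f : mor Y Z), cmp f (zer X Y) = zer X Z
}.

Infix "\**" := cmp (at level 40, left associativity).

Definition op_cat (C : zcat) : zcat.
Proof.
apply: (@ZCat C (fun X Y => mor Y X) (@idm C) (fun X Y Z g f => f \** g)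
  (fun X Y => @zer C Y X)) => *; rewrite /= ?cmpA ?cmp1l ?cmp1r ?cmp0l ?cmp0r //.
Defined.

Section CatNotions.
Variable C : zcat.
Implicit Types (W X Y Z P K : C).

Definition ciso X Y :=
  exists (f : mor X Y) (g : mor Y X), g \** f = idm X /\ f \** g = idm Y.

Definition epi Y Z (p : mor Y Z) :=
  forall W (u v : mor Z W), u \** p = v \** p -> u = v.

Definition cprojective P :=
  forall Y Z (p : mor Y Z) (g : mor P Z), epi p -> exists h, p \** h = g.

Definition is_ckernel K Y Z (i : mor K Y) (p : mor Y Z) :=
  [/\ p \** i = zer K Z,
      forall W (f : mor W Y), p \** f = zer W Z -> exists h, i \** h = f
    & forall W (g h : mor W K), i \** g = i \** h -> g = h].

(** Projective dimension at most 1; in the opposite of a module category the same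
    condition says that the injective dimension is at most 1. *)
Definition has_short_resolution X :=
  exists P1 P0 (i : mor P1 P0) (p : mor P0 X),
    [/\ cprojective P1, cprojective P0, epi p & is_ckernel i p].

Definition cpd_one X := has_short_resolution X /\ ~ cprojective X.

(** Having no idempotents but 0 and 1 is a self-dual condition, unlike the
    decomposition into submodules. *)
Definition cindecomposable X :=
  idm X <> zer X X /\
  forall e : mor X X, e \** e = e -> e = zer X X \/ e = idm X.

Definition finitely_many_up_to_ciso (Q : C -> Prop) :=
  exists (n : nat) (E : 'I_n -> C), forall X, Q X -> exists i, ciso X (E i).

Definition cright_glued :=
  finitely_many_up_to_ciso (fun X => cindecomposable X /\ ~ cpd_one X).

Definition crep_finite := finitely_many_up_to_ciso cindecomposable.

Lemma ciso_sym X Y : ciso X Y -> ciso Y X.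
Proof. by case=> f [g [gf fg]]; exists g, f. Qed.

Lemma ciso_trans Y X Z : ciso X Y -> ciso Y Z -> ciso X Z.
Proof.
case=> f [g [gf fg]] [f' [g' [gf' fg']]]; exists (f' \** f), (g \** g').
split; first by rewrite cmpA -(cmpA g) gf' cmp1r.
by rewrite cmpA -(cmpA f') fg cmp1r.
Qed.

Lemma cprojective_iso X Y : ciso X Y -> cprojective X -> cprojective Y.
Proof.
case=> f [g [gf fg]] pX U V p h p_epi; have [h' h'E] := pX _ _ p (h \** f) p_epi.
by exists (h' \** g); rewrite cmpA h'E -cmpA fg cmp1r.
Qed.

Lemma has_short_resolution_iso X Y :
  ciso X Y -> has_short_resolution X -> has_short_resolution Y.
Proof.
case=> a [b [ba ab]] [P1 [P0 [i [p [pr1 pr0 p_epi [pi0 p_ker i_mono]]]]]].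
exists P1, P0, i, (a \** p); split=> //.
  move=> W u v; rewrite !cmpA => /p_epi uv.
  by rewrite -[u]cmp1r -ab cmpA uv -cmpA ab cmp1r.
split=> // [|W f apf]; first by rewrite -cmpA pi0 cmp0r.
by apply: p_ker; rewrite -[p]cmp1l -ba -!cmpA cmpA -!cmpA [a \** _]cmpA apf cmp0r.
Qed.

Lemma cpd_one_iso X Y : ciso X Y -> cpd_one X -> cpd_one Y.
Proof.
move=> XY [rX npX]; split; first exact: has_short_resolution_iso rX.
by move=> /(cprojective_iso (ciso_sym XY)).
Qed.

Lemma cindecomposable_iso X Y : ciso X Y -> cindecomposable X -> cindecomposable Y.
Proof.
case=> a [b [ba ab]] [nzX idemX]; split=> [idY0 | e ee].
  by case: nzX; rewrite -ba -[b]cmp1r idY0 cmp0r cmp0l.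
have aeb : a \** (b \** e \** a) \** b = e.
  by rewrite !cmpA ab cmp1l -cmpA ab cmp1r.
have [|e0|e1] := idemX (b \** e \** a).
- by rewrite !cmpA -(cmpA _ a) ab cmp1r -(cmpA b) ee.
- by left; rewrite -aeb e0 cmp0r cmp0l.
- by right; rewrite -aeb e1 cmp1r.
Qed.

End CatNotions.

Record equivalence (C D : zcat) := Equivalence {
  eob :> C -> D;
  emor : forall X Y : C, mor X Y -> mor (eob X) (eob Y);
  emor_id : forall X, emor (idm X) = idm (eob X);
  emor_cmp : forall X Y Z (g : mor Y Z) (f : mor X Y),
    emor (g \** f) = emor g \** emor f;
  emor_zer : forall X Y, emor (zer X Y) = zer (eob X) (eob Y);
  emor_inj : forall X Y (f g : mor X Y), emor f = emor g -> f = g;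
  emor_full : forall X Y (g : mor (eob X) (eob Y)), exists f, emor f = g;
  eob_ess : forall Y, exists X, ciso (eob X) Y
}.

Definition op_equivalence (C D : zcat) (F : equivalence C D) :
  equivalence (op_cat C) (op_cat D).
Proof.
apply: (@Equivalence (op_cat C) (op_cat D) (eob F) (fun X Y => @emor _ _ F Y X)) => //=.
- exact: emor_id.
- by move=> X Y Z g f; apply: emor_cmp.
- by move=> X Y; apply: emor_zer.
- by move=> X Y; apply: emor_inj.
- by move=> X Y g; apply: emor_full.
move=> Y; have [X [f [g [gf fg]]]] := eob_ess F Y.
by exists X, g, f.
Qed.

(** The pattern of the following proofs: test objects and test morphisms of the
    target are brought back to the source along the isomorphisms of eob_ess. *)
Section EquivalenceInvariance.
Variables (C D : zcat) (F : equivalence C D).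
Implicit Types X Y P : C.

Local Notation Fm := (emor F).

Lemma emor_epi X Y (p : mor X Y) : epi p -> epi (Fm p).
Proof.
move=> p_epi W' u v uv; have [W [a [b [ba ab]]]] := eob_ess F W'.
have [u' u'E] := emor_full (b \** u); have [v' v'E] := emor_full (b \** v).
have uv' : u' = v'.
  by apply/p_epi/(emor_inj (e := F)); rewrite !emor_cmp u'E v'E -!cmpA uv.
by rewrite -[u]cmp1l -ab -cmpA -u'E uv' v'E cmpA ab cmp1l.
Qed.

Lemma emor_epi_inv X Y (p : mor X Y) : epi (Fm p) -> epi p.
Proof.
move=> Fp_epi W u v uv; apply: (emor_inj (e := F)); apply: Fp_epi.
by rewrite -!emor_cmp uv.
Qed.

Lemma eob_projective P : cprojective P -> cprojective (F P).
Proof.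
move=> prP X' Y' p g p_epi.
have [X [a [b [ba ab]]]] := eob_ess F X'; have [Y [c [d [dc cd]]]] := eob_ess F Y'.
have [p' p'E] := emor_full (d \** p \** a); have [g' g'E] := emor_full (d \** g).
have [|h hE] := prP _ _ p' g'.
  apply: emor_epi_inv => W u v; rewrite p'E !cmpA => uv.
  have {}uv : u \** d \** p = v \** d \** p.
    by rewrite -[LHS]cmp1r -[RHS]cmp1r -ab !cmpA uv.
  by move: (p_epi _ _ _ uv) => {}uv; rewrite -[u]cmp1r -dc cmpA uv -cmpA dc cmp1r.
exists (a \** emor F h).
rewrite -[p]cmp1l -cd -!cmpA [p \** _]cmpA ![d \** _]cmpA.
by rewrite -p'E -emor_cmp hE g'E cmpA cd cmp1l.
Qed.

Lemma eob_projective_inv P : cprojective (F P) -> cprojective P.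
Proof.
move=> prFP X Y p g p_epi.
have [h hE] := prFP _ _ _ (emor F g) (emor_epi p_epi).
have [h' h'E] := emor_full h.
by exists h'; apply: (emor_inj (e := F)); rewrite emor_cmp h'E hE.
Qed.

Lemma emor_kernel X Y Z (i : mor X Y) (p : mor Y Z) :
  is_ckernel i p -> is_ckernel (Fm i) (Fm p).
Proof.
case=> pi0 p_ker i_mono; split=> [|W' f pf|W' g h gh].
- by rewrite -emor_cmp pi0 emor_zer.
- have [W [a [b [ba ab]]]] := eob_ess F W'; have [f' f'E] := emor_full (f \** a).
  have [|h hE] := p_ker _ f'.
    by apply: (emor_inj (e := F)); rewrite emor_cmp f'E cmpA pf cmp0l emor_zer.
  by exists (emor F h \** b); rewrite cmpA -emor_cmp hE f'E -cmpA ab cmp1r.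
have [W [a [b [ba ab]]]] := eob_ess F W'.
have [g' g'E] := emor_full (g \** a); have [h' h'E] := emor_full (h \** a).
have gh' : g' = h'.
  by apply/i_mono/(emor_inj (e := F)); rewrite !emor_cmp g'E h'E !cmpA gh.
by rewrite -[g]cmp1r -ab cmpA -g'E gh' h'E -cmpA ab cmp1r.
Qed.

Lemma eob_pd_one X : cpd_one X -> cpd_one (F X).
Proof.
case=> [[P1 [P0 [i [p [pr1 pr0 p_epi p_ker]]]]] npX]; split; last first.
  by move=> /eob_projective_inv.
exists (F P1), (F P0), (emor F i), (emor F p); split.
- exact: eob_projective.
- exact: eob_projective.
- exact: emor_epi.
- exact: emor_kernel.
Qed.

Lemma eob_indecomposable X : cindecomposable X <-> cindecomposable (F X).
Proof.
split=> -[nz idem]; split=> [id0 | e ee].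
- by case: nz; apply: (emor_inj (e := F)); rewrite emor_id id0 emor_zer.
- have [e' e'E] := emor_full e.
  have [|e0|e1] := idem e'.
  + by apply: (emor_inj (e := F)); rewrite emor_cmp e'E ee.
  + by left; rewrite -e'E e0 emor_zer.
  + by right; rewrite -e'E e1 emor_id.
- by case: nz; rewrite -emor_id id0 emor_zer.
have [|e0|e1] := idem (emor F e); first by rewrite -emor_cmp ee.
  by left; apply: (emor_inj (e := F)); rewrite e0 emor_zer.
by right; apply: (emor_inj (e := F)); rewrite e1 emor_id.
Qed.

Lemma eob_iso X Y : ciso X Y -> ciso (F X) (F Y).
Proof.
case=> f [g [gf fg]]; exists (emor F f), (emor F g).
by rewrite -!emor_cmp gf fg !emor_id.
Qed.

Lemma eob_iso_inv X Y : ciso (F X) (F Y) -> ciso X Y.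
Proof.
case=> f [g [gf fg]]; have [f' f'E] := emor_full f; have [g' g'E] := emor_full g.
exists f', g'; split; apply: (emor_inj (e := F)).
  by rewrite emor_cmp f'E g'E gf emor_id.
by rewrite emor_cmp f'E g'E fg emor_id.
Qed.

Lemma equivalence_right_glued : cright_glued C -> cright_glued D.
Proof.
case=> n [E HE]; exists n, (fun i => F (E i)) => Y [indY npdY].
have [X XY] := eob_ess F Y.
have [|i Xi] := HE X.
  split; first exact/eob_indecomposable/(cindecomposable_iso (ciso_sym XY)).
  by move=> /eob_pd_one/(cpd_one_iso XY).
by exists i; apply: ciso_trans (ciso_sym XY) (eob_iso Xi).
Qed.

Lemma equivalence_rep_finite : crep_finite D -> crep_finite C.
Proof.
case=> n [E HE].
have /fin_all_exists[E' E'P] i := eob_ess F (E i).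
exists n, E' => X indX; have [|i Xi] := HE (F X); first exact/eob_indecomposable.
by exists i; apply: eob_iso_inv; apply: ciso_trans Xi (ciso_sym (E'P i)).
Qed.

End EquivalenceInvariance.

Lemma op_rep_finite (C : zcat) : crep_finite (op_cat C) -> crep_finite C.
Proof.
case=> n [E HE]; exists n, E => X [nz idem].
have [|i [f [g [gf fg]]]] := HE X; first by split=> // e; apply: idem.
by exists i, g, f.
Qed.

(** * The category of modules *)

Definition rmod_cat (k : fieldType) (A : falgType k) : zcat :=
  @ZCat (rmod A) (@rhom k A) (@rid k A) (@rcomp k A) (fun X Y => 0)
    (@rcompA k A) (@rcomp1l k A) (@rcomp1 k A) (@rcomp0l k A) (@rcomp0 k A).

Section ModuleCategory.
Variables (k : fieldType) (A : falgType k).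
Implicit Types (X Y Z P M : rmod A).
Local Notation mods := (rmod_cat A).
Local Notation opmods := (op_cat (rmod_cat A)).

Lemma rhom0P X Y (f : rhom X Y) : (forall x, f x = 0) -> f = 0.
Proof. by move=> f0; apply: rhomP => x; rewrite f0 rhomE. Qed.

Lemma rhom_injP X Y (f : rhom X Y) : (forall x, f x = 0 -> x = 0) -> injective f.
Proof.
move=> f0 x y fxy; apply/eqP; rewrite -subr_eq0; apply/eqP/f0.
by rewrite linearB /= fxy subrr.
Qed.

Lemma rhom_lker0P X Y (f : rhom X Y) : lker f = 0%VS <-> injective f.
Proof.
by split=> [/eqP/lker0P | f_inj]; last by apply/eqP/lker0P.
Qed.

Lemma rhom_surjP X Y (f : rhom X Y) :
  rhom_surjective f <-> forall y, exists x, f x = y.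
Proof.
split=> [f_surj y | f_surj].
  by have := memvf y; rewrite -f_surj => /memv_imgP[x _ ->]; exists x.
apply/vspaceP => y; rewrite memvf.
by have [x <-] := f_surj y; apply/memv_img/memvf.
Qed.

Lemma is_submod_lker X Y (f : rhom X Y) : is_submod (lker f).
Proof. by move=> x a; rewrite !memv_ker rhomM => /eqP ->; rewrite ract0. Qed.

Lemma is_submod_limg X Y (f : rhom X Y) : is_submod (limg f).
Proof.
by move=> y a /memv_imgP[x _ ->]; rewrite -rhomM; apply/memv_img/memvf.
Qed.

Lemma kernelP X Y (f : rhom X Y) : exists (K : rmod A) (i : rhom K X),
  injective i /\ forall x, f x = 0 <-> exists u, x = i u.
Proof.
have [i [i_inj iP]] := sub_inclP (@is_submod_lker X Y f).
exists _, i; split=> // x; rewrite -iP memv_ker.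
by split=> /eqP.
Qed.

Lemma cokernelP X Y (f : rhom X Y) : exists (Q : rmod A) (p : rhom Y Q),
  (forall z, exists y, z = p y) /\ forall y, p y = 0 <-> exists x, y = f x.
Proof.
have [Q [p [p_surj pP]]] := quot_projP (@is_submod_limg X Y f).
exists Q, p; split=> // y; rewrite pP.
split=> [/memv_imgP[x _ ->] | [x ->]]; first by exists x.
exact/memv_img/memvf.
Qed.

(** An epimorphism is onto because its cokernel vanishes. *)
Lemma epi_surjP X Y (p : rhom X Y) :
  epi (C := mods) p <-> forall y, exists x, p x = y.
Proof.
split=> [p_epi y | p_surj Z u v uv]; last first.
  apply: rhomP => y; have [x <-] := p_surj y.
  by rewrite -!rcompE; congr (rhom_lfun _ x).
have [Q [q [_ qP]]] := cokernelP p.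
have q0 : q = 0.
  apply: (p_epi Q); change (q \* p = 0 \* p); rewrite rcomp0l.
  by apply: rhom0P => x; rewrite rhomE; apply/qP; exists x.
by have [|x ->] := proj1 (qP y); [rewrite q0 rhomE | exists x].
Qed.

(** An epimorphism of the opposite category is a monomorphism, and a monomorphism
    is injective because its kernel vanishes. *)
Lemma mono_injP X Y (i : rhom X Y) : epi (C := opmods) i <-> injective i.
Proof.
split=> [i_mono | i_inj Z u v uv]; last first.
  by apply: rhomP => z; apply: i_inj; rewrite -!rcompE; congr (rhom_lfun _ z).
apply: rhom_injP => x ix0; have [K [j [_ jP]]] := kernelP i.
have j0 : j = 0.
  apply: (i_mono K); change (i \* j = i \* 0); rewrite rcomp0.
  by apply: rhom0P => u; rewrite rhomE; apply/jP; exists u.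
by have [u ->] := proj1 (jP x) ix0; rewrite j0 rhomE.
Qed.

Lemma lift_inj X Y Z (i : rhom X Y) (f : rhom Z Y) : injective i ->
  (forall z, exists x, f z = i x) -> exists g, i \* g = f.
Proof.
move=> i_inj fi; have iK x : (i^-1)%VF (i x) = x by apply/lker0_lfunK/lker0P.
have fK z : i ((i^-1)%VF (f z)) = f z by have [x ->] := fi z; rewrite iK.
have [|z a|g gE] := @rhom_ofP _ _ Z X (fun z => (i^-1)%VF (f z)).
- by move=> c x y; rewrite !linearP.
- by apply: i_inj; rewrite fK !rhomM fK.
by exists g; apply: rhomP => z; rewrite rhomE gE fK.
Qed.

Lemma descend_surj X Y Z (p : rhom X Y) (f : rhom X Z) :
    (forall y, exists x, p x = y) -> (forall x, p x = 0 -> f x = 0) ->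
  exists g, g \* p = f.
Proof.
move=> p_surj fp; have pV y : p ((p^-1)%VF y) = y.
  by apply: limg_lfunVK; rewrite (proj2 (rhom_surjP p) p_surj) memvf.
have fpV x : f ((p^-1)%VF (p x)) = f x.
  by apply/eqP; rewrite -subr_eq0 -linearB; apply/eqP/fp; rewrite linearB /= pV subrr.
have [|y a|g gE] := @rhom_ofP _ _ Y Z (fun y => f ((p^-1)%VF y)).
- by move=> c x y; rewrite !linearP.
- by rewrite -[y in LHS]pV -rhomM fpV rhomM.
by exists g; apply: rhomP => x; rewrite rhomE gE fpV.
Qed.

Lemma is_ckernelP X Y Z (i : rhom X Y) (p : rhom Y Z) :
  is_ckernel (C := mods) i p <->
  injective i /\ forall y, p y = 0 <-> exists x, y = i x.
Proof.
split=> [[pi0 p_ker i_mono] | [i_inj ip]].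
  split=> [|y]; first by apply/mono_injP => W u v; apply: i_mono.
  split=> [py0 | [x ->]]; last by rewrite -rcompE [p \* i]pi0 rhomE.
  have [K [j [_ jP]]] := kernelP p; have [|h hE] := p_ker K j.
    by apply: rhom0P => u; rewrite rhomE; apply/jP; exists u.
  by have [u ->] := proj1 (jP y) py0; exists (h u); rewrite -hE -rcompE.
split=> [|W f pf|W]; last by have := proj2 (mono_injP i) i_inj W.
  by apply: rhom0P => x; rewrite rhomE; apply/ip; exists x.
apply: lift_inj => // w; have [|x ->] := proj1 (ip (f w)); last by exists x.
by rewrite -rcompE [p \* f]pf rhomE.
Qed.

Lemma op_is_ckernel X Y Z (i : rhom X Y) (p : rhom Y Z) :
    (forall z, exists y, p y = z) -> (forall y, p y = 0 <-> exists x, y = i x) ->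
  is_ckernel (C := opmods) p i.
Proof.
move=> p_surj ip; split=> [|W f fi|]; last exact: (proj2 (epi_surjP p) p_surj).
  by apply: rhom0P => x; rewrite rhomE; apply/ip; exists x.
apply: descend_surj => // y /ip[x ->].
by rewrite -rcompE [f \* i]fi rhomE.
Qed.

Lemma projective_rmodP P : projective_rmod P <-> cprojective (C := mods) P.
Proof.
split=> prP X Y p g; last first.
  move=> Hp p_surj Hg; have [|h hE] := prP X Y (mk_rhom Hp) (mk_rhom Hg).
    exact/epi_surjP/rhom_surjP.
  by exists h; split; [exact: is_rhom_rhom | rewrite -[g](mk_rhomE Hg) -hE].
move=> /epi_surjP/rhom_surjP p_surj.
have [h [Hh hE]] := prP X Y p g (is_rhom_rhom p) p_surj (is_rhom_rhom g).
by exists (mk_rhom Hh); apply: val_inj.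
Qed.

Lemma injective_rmodP M : injective_rmod M <-> cprojective (C := opmods) M.
Proof.
split=> inM => [Y X i g | X Y i g]; last first.
  move=> Hi i_inj Hg; have [|h hE] := inM Y X (mk_rhom Hi) (mk_rhom Hg).
    exact/mono_injP/rhom_lker0P.
  by exists h; split; [exact: is_rhom_rhom | rewrite -[g](mk_rhomE Hg) -hE].
move=> /mono_injP/rhom_lker0P i_inj.
have [h [Hh hE]] := inM X Y i g (is_rhom_rhom i) i_inj (is_rhom_rhom g).
by exists (mk_rhom Hh); apply: val_inj.
Qed.

Lemma is_zeroP M : is_zero M <-> forall x : M, x = 0.
Proof.
rewrite /is_zero; split=> [/eqP | M0].
  by rewrite dimv_eq0 => /eqP M0 x; apply/eqP; rewrite -memv0 -M0 memvf.
apply/eqP; rewrite dimv_eq0 -subv0; apply/subvP => x _.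
by rewrite (M0 x) mem0v.
Qed.

Lemma is_zero_rid M : is_zero M <-> rid M = 0.
Proof.
rewrite is_zeroP; split=> [M0 | id0 x]; first by apply: rhom0P => x; apply: M0.
by rewrite -[x]ridE id0 rhomE.
Qed.

Lemma rmod0_eq0 (x : rmod0 A) : x = 0.
Proof. exact: thinmx0. Qed.

Lemma is_zero_rmod0 : is_zero (rmod0 A).
Proof. exact/is_zeroP/rmod0_eq0. Qed.

Lemma rmod0_vspace (U V : {vspace rmod0 A}) : U = V.
Proof. by apply/vspaceP => x; rewrite (rmod0_eq0 x) !mem0v. Qed.

Lemma projective_rmod0 : projective_rmod (rmod0 A).
Proof.
move=> X Y p g _ _ _; exists 0; split=> [x a|]; first by rewrite !zero_lfunE ract0.
by apply/lfunP => x; rewrite (rmod0_eq0 x) !linear0.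
Qed.

Lemma injective_rmod0 : injective_rmod (rmod0 A).
Proof.
move=> X Y i g _ _ _; exists 0; split=> [x a|]; first by rewrite !zero_lfunE ract0.
by apply/lfunP => x; rewrite (rmod0_eq0 (g x)) comp_lfunE zero_lfunE.
Qed.

Lemma pd_le0_projective M : projective_rmod M -> pd_le M 0.
Proof.
move=> prM; pose P i := if i is 0%N then M else rmod0 A.
exists P, (fun i => 0 : 'Hom(P i.+1, P i)), (\1%VF : 'Hom(P 0%N, M)).
split; last by case=> // i _; exact: is_zero_rmod0.
split=> /=.
- by case=> [|i] //=; exact: projective_rmod0.
- by move=> i x a; rewrite !zero_lfunE ract0.
- exact: is_rhom_id.
- exact: lim1g.
- by rewrite lim0g; apply/esym/eqP/lker0P => x y; rewrite !id_lfunE.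
- by move=> i; exact: rmod0_vspace.
Qed.

Lemma id_le0_injective M : injective_rmod M -> id_le M 0.
Proof.
move=> inM; pose I i := if i is 0%N then M else rmod0 A.
exists I, (fun i => 0 : 'Hom(I i, I i.+1)), (\1%VF : 'Hom(M, I 0%N)).
split; last by case=> // i _; exact: is_zero_rmod0.
split=> /=.
- by case=> [|i] //=; exact: injective_rmod0.
- by move=> i x a; rewrite !zero_lfunE ract0.
- exact: is_rhom_id.
- by apply/eqP/lker0P => x y; rewrite !id_lfunE.
- rewrite lim1g; apply/esym/vspaceP => x.
  by rewrite memvf memv_ker zero_lfunE eqxx.
- by move=> i; exact: rmod0_vspace.
Qed.

(** A resolution with P 2 = 0 is a short exact sequence, since then P 1 -> P 0 is
    injective; a projective module would have dimension 0. *)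
Lemma pd_eq1_cpd_one M : pd_eq M 1 -> cpd_one (C := mods) M.
Proof.
case=> [[P [d [e [[prP Hd He e_surj ex0 ex] P0]]]] pd_min]; split; last first.
  by move=> /projective_rmodP/pd_le0_projective/pd_min.
have d1_inj : lker (d 0%N) = 0%VS.
  rewrite -ex; apply/eqP; rewrite -subv0; apply/subvP => y /memv_imgP[x _ ->].
  by have /is_zeroP/(_ x)-> := P0 2 isT; rewrite linear0 mem0v.
exists (P 1), (P 0%N), (mk_rhom (Hd 0%N)), (mk_rhom He); split.
- exact/projective_rmodP/prP.
- exact/projective_rmodP/prP.
- exact/epi_surjP/rhom_surjP.
apply/is_ckernelP; split; first exact/rhom_lker0P.
move=> y; split=> [/eqP | [x ->]].
  by rewrite mk_rhomE -memv_ker -ex0 => /memv_imgP[x _ ->]; exists x.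
by apply/eqP; rewrite mk_rhomE -memv_ker -ex0 memv_img ?memvf.
Qed.

Lemma id_eq1_cpd_one M : id_eq M 1 -> cpd_one (C := opmods) M.
Proof.
case=> [[I [d [e [[inI Hd He e_inj ex0 ex] I0]]]] id_min]; split; last first.
  by move=> /injective_rmodP/id_le0_injective/id_min.
have d0_surj : rhom_surjective (d 0%N).
  rewrite /rhom_surjective ex; apply/vspaceP => y; rewrite memvf memv_ker.
  by apply/eqP; have /is_zeroP := I0 2 isT; apply.
exists (I 1), (I 0%N), (mk_rhom (Hd 0%N)), (mk_rhom He); split.
- exact/injective_rmodP/inI.
- exact/injective_rmodP/inI.
- exact/mono_injP/rhom_lker0P.
apply: op_is_ckernel => [|y]; first exact/rhom_surjP.
split=> [/eqP | [x ->]].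
  by rewrite mk_rhomE -memv_ker -ex0 => /memv_imgP[x _ ->]; exists x.
by apply/eqP; rewrite mk_rhomE -memv_ker -ex0 memv_img ?memvf.
Qed.

(** An idempotent endomorphism decomposes the module into image and kernel, and
    the projection attached to a decomposition is an idempotent. *)
Lemma indecomposableP M : indecomposable M <-> cindecomposable (C := mods) M.
Proof.
split=> [[nzM indM] | [nzM idemM]].
  split=> [/is_zero_rid // | e ee].
  have eK x : e (e x) = e x by rewrite -rcompE [e \* e]ee.
  have [|| e0 | e1] := indM (limg e) (lker e) (@is_submod_limg _ _ e) (@is_submod_lker _ _ e).
  - apply/vspaceP => x; rewrite memvf -[x](subrK (e x)) addrC; apply: memv_add.
      exact/memv_img/memvf.
    by rewrite memv_ker linearB /= eK subrr.
  - apply/eqP; rewrite -subv0; apply/subvP => x /memv_capP[/memv_imgP[y _ ->]].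
    by rewrite memv_ker eK memv0.
  - left; apply: rhom0P => x; apply/eqP; rewrite -memv0 -e0.
    exact/memv_img/memvf.
  right; apply: rhomP => x; move/rhom_lker0P: e1 => /(_ (e x) x); rewrite eK ridE.
  by apply.
split=> [/is_zero_rid // | U V subU subV UV UV0].
have VU0 : (V :&: U)%VS = 0%VS by rewrite capvC.
have piD x : daddv_pi U V x + daddv_pi V U x = x.
  by rewrite daddv_pi_add// UV memvf.
have piV x : x \in V -> daddv_pi U V x = 0.
  by move=> xV; have := piD x; rewrite (daddv_pi_id VU0 xV) => /(canRL (addrK _)); rewrite subrr.
have pi_rhom : is_rhom (daddv_pi U V).
  move=> x a; rewrite -{1}[x]piD ractDl linearD /= [X in X + _ = _]daddv_pi_id//; last first.
    exact: (subU _ a (memv_pi _ _ _)).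
  by rewrite [X in _ + X]piV ?addr0//; exact: (subV _ a (memv_pi _ _ _)).
case: (idemM (mk_rhom pi_rhom)) => [|e0|e1].
- by apply: rhomP => x; rewrite rhomE !mk_rhomE daddv_pi_proj.
- left; apply/eqP; rewrite -subv0; apply/subvP => x xU.
  by rewrite -(daddv_pi_id UV0 xU) -(mk_rhomE pi_rhom) e0 rhomE mem0v.
- right; apply/eqP; rewrite -subv0; apply/subvP => x xV.
  by rewrite memv0 -[x]ridE -[rid M]e1 mk_rhomE piV.
Qed.

Lemma bij_ciso X Y (f : rhom X Y) :
  injective f -> (forall y, exists x, f x = y) -> ciso (C := mods) X Y.
Proof.
move=> f_inj f_surj; have [|g gE] := lift_inj (f := rid Y) f_inj.
  by move=> y; have [x <-] := f_surj y; exists x; rewrite ridE.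
exists f, g; split=> //; apply: rhomP => x; apply: f_inj.
by rewrite rhomE -rcompE gE !rhomE.
Qed.

Lemma isomorphicP X Y : isomorphic X Y <-> ciso (C := mods) X Y.
Proof.
split=> [[f [Hf f_inj f_surj]] | [f [g [gf fg]]]].
  by apply: (@bij_ciso _ _ (mk_rhom Hf)); [exact/rhom_lker0P | exact/rhom_surjP].
have gK x : g (f x) = x by rewrite -rcompE [g \* f]gf ridE.
have fK y : f (g y) = y by rewrite -rcompE [f \* g]fg ridE.
exists f; split; [exact: is_rhom_rhom | exact/rhom_lker0P/(can_inj gK) |].
by apply/rhom_surjP => y; exists (g y).
Qed.

Lemma right_glued_cright_glued : right_glued A -> cright_glued mods.
Proof.
case=> n [E HE]; exists n, E => X [indX npdX].
have [|i Xi] := HE X; last by exists i; apply/isomorphicP.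
by split=> [|/pd_eq1_cpd_one //]; apply/indecomposableP.
Qed.

Lemma left_glued_cright_glued : left_glued A -> cright_glued opmods.
Proof.
case=> n [E HE]; exists n, E => X [indX npdX].
have [|i Xi] := HE X; last first.
  by have [f [g [gf fg]]] := proj1 (isomorphicP _ _) Xi; exists i, g, f.
split=> [|/id_eq1_cpd_one //]; apply/indecomposableP.
by case: indX => nz idem; split=> // e; apply: idem.
Qed.

Lemma crep_finite_rep_finite : crep_finite mods -> rep_finite A.
Proof.
case=> n [E HE]; exists n, E => X /indecomposableP indX.
by have [i Xi] := HE X indX; exists i; apply/isomorphicP.
Qed.

End ModuleCategory.

(** * Duality *)

Section OppositeAlgebra.
Variables (k : fieldType) (A : falgType k).

HB.instance Definition _ := GRing.Lmodule.copy A^c A.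
HB.instance Definition _ := GRing.Lmodule_isLalgebra.Build k A^c
  (fun c (x y : A) => scalerAr c y x).
HB.instance Definition _ := GRing.Lalgebra_isAlgebra.Build k A^c
  (fun c (x y : A) => scalerAl c y x).
HB.instance Definition _ := Vector.copy A^c A.

End OppositeAlgebra.

Section LinearForms.
Variables (k : fieldType) (V : vectType k).

Definition dual_basis (i : 'I_(\dim {:V})) : 'Hom(V, k^o) :=
  linfun (coord (vbasis {:V}) i : V -> k^o).

Lemma dual_basisE i x : dual_basis i x = coord (vbasis {:V}) i x.
Proof. by rewrite lfunE. Qed.

Lemma dual_basis_sum (xi : 'Hom(V, k^o)) :
  xi = \sum_(i < \dim {:V}) xi (vbasis {:V})`_i *: dual_basis i.
Proof.
apply/lfunP => x; rewrite [in LHS](coord_vbasis (memvf x)) linear_sum sum_lfunE.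
apply: eq_bigr => i _; rewrite linearZ scale_lfunE dual_basisE.
exact: mulrC.
Qed.

Lemma linear_form_sep x : (forall xi : 'Hom(V, k^o), xi x = 0) -> x = 0.
Proof.
move=> x0; rewrite (coord_vbasis (memvf x)); apply: big1 => i _.
by rewrite -dual_basisE x0 scale0r.
Qed.

Lemma linear_form_sep_eq x y : (forall xi : 'Hom(V, k^o), xi x = xi y) -> x = y.
Proof.
move=> xy; apply/eqP; rewrite -subr_eq0; apply/eqP/linear_form_sep => xi.
by rewrite linearB /= xy subrr.
Qed.

(** A form Psi on the dual space is the evaluation at a vector: the coordinates of
    that vector are the values of Psi at the dual basis. *)
Lemma linear_form_reflexive (Psi : 'Hom(V, k^o) -> k^o) : linear Psi ->
  forall xi : 'Hom(V, k^o), xi (\sum_(i < \dim {:V}) Psi (dual_basis i) *: (vbasis {:V})`_i) = Psi xi.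
Proof.
move=> lin_Psi xi; pose Psi' : {linear 'Hom(V, k^o) -> k^o} :=
  HB.pack Psi (GRing.isLinear.Build k _ _ _ Psi lin_Psi).
rewrite [in RHS](dual_basis_sum xi) -[Psi _]/(Psi' _) !linear_sum.
by apply: eq_bigr => i _; rewrite !linearZ; apply: mulrC.
Qed.

End LinearForms.

Section Dual.
Variables (k : fieldType) (A : falgType k).
Implicit Types (X Y Z M : rmod A).

Definition dual_act M (xi : 'Hom(M, k^o)) (a : A^c) : 'Hom(M, k^o) :=
  (xi \o ract_lfun M a)%VF.

Lemma dual_actE M (xi : 'Hom(M, k^o)) (a : A^c) x :
  dual_act xi a x = xi (ract x a).
Proof. by rewrite comp_lfunE ract_lfunE. Qed.

Definition dual M : rmod A^c.
Proof.
exists 'Hom(M, k^o) (@dual_act M) => *; apply/lfunP => x;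
  rewrite ?(add_lfunE, scale_lfunE, dual_actE) //.
- by rewrite ractDr linearD.
- by rewrite ractZr linearZ.
- by rewrite ract1.
- by rewrite ractM.
Defined.

Fact dual_hom_sig X Y (f : rhom X Y) : {g : rhom (dual Y) (dual X) |
  forall xi, g xi = ((xi : 'Hom(Y, k^o)) \o f)%VF}.
Proof.
apply: rhom_ofP => [c xi1 xi2 | xi a].
  by apply/lfunP => x; rewrite !(comp_lfunE, add_lfunE, scale_lfunE).
apply/lfunP => x; rewrite comp_lfunE.
transitivity ((xi : 'Hom(Y, k^o)) (ract (f x) a)); first exact: dual_actE.
by rewrite -rhomM -(comp_lfunE _ f); apply/esym/dual_actE.
Qed.

Definition dual_hom X Y (f : rhom X Y) : rhom (dual Y) (dual X) :=
  proj1_sig (dual_hom_sig f).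

Lemma dual_homE X Y (f : rhom X Y) (xi : dual Y) (x : X) :
  (dual_hom f xi : 'Hom(X, k^o)) x = (xi : 'Hom(Y, k^o)) (f x).
Proof. by rewrite /dual_hom; case: (dual_hom_sig f) => g /= ->; rewrite comp_lfunE. Qed.

Lemma dual_homP X Y (f g : rhom (dual X) (dual Y)) :
  (forall xi y, (f xi : 'Hom(Y, k^o)) y = (g xi : 'Hom(Y, k^o)) y) -> f = g.
Proof. by move=> fg; apply: rhomP => xi; apply/lfunP => y; apply: fg. Qed.

Lemma dual_hom_linear X Y : linear (@dual_hom X Y).
Proof.
move=> c f g; apply: dual_homP => xi x; rewrite !(rhomE, dual_homE).
by rewrite linearP add_lfunE scale_lfunE !dual_homE.
Qed.

Lemma dual_hom_id X : dual_hom (rid X) = rid (dual X).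
Proof. by apply: dual_homP => xi x; rewrite !(dual_homE, rhomE). Qed.

Lemma dual_hom_comp X Y Z (g : rhom Y Z) (f : rhom X Y) :
  dual_hom (g \* f) = dual_hom f \* dual_hom g.
Proof. by apply: dual_homP => xi x; rewrite !(dual_homE, rhomE). Qed.

Lemma dual_hom0 X Y : dual_hom (0 : rhom X Y) = 0.
Proof.
by apply: dual_homP => xi x; rewrite !(dual_homE, rhomE) linear0 zero_lfunE.
Qed.

Lemma dual_hom_inj X Y : injective (@dual_hom X Y).
Proof.
move=> f g fg; apply: rhomP => x; apply: linear_form_sep_eq => xi.
by rewrite -!dual_homE fg.
Qed.

(** Every map between dual spaces is the transpose of a map f0 by reflexivity; it
    is a homomorphism because linear forms separate points. *)
Lemma dual_hom_full X Y (g : rhom (dual Y) (dual X)) : exists f, dual_hom f = g.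
Proof.
pose f0 x : Y :=
  \sum_(i < \dim {:Y}) (g (dual_basis i) : 'Hom(X, k^o)) x *: (vbasis {:Y})`_i.
have f0E x (xi : 'Hom(Y, k^o)) : xi (f0 x) = (g xi : 'Hom(X, k^o)) x.
  apply: (linear_form_reflexive (Psi := fun xi => (g xi : 'Hom(X, k^o)) x)).
  by move=> c xi1 xi2; rewrite linearP add_lfunE scale_lfunE.
have [c x y|x a|f fE] := @rhom_ofP _ _ X Y f0.
- by apply: linear_form_sep_eq => xi; rewrite f0E !linearP /= !f0E.
- apply: linear_form_sep_eq => xi; rewrite -dual_actE !f0E.
  by rewrite (rhomM g xi a : g (dual_act xi a) = _); apply/esym/dual_actE.
by exists f; apply: dual_homP => xi x; rewrite dual_homE fE f0E.
Qed.

Section Predual.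
Variable Z : rmod A^c.

Definition predual_act (xi : 'Hom(Z, k^o)) (a : A) : 'Hom(Z, k^o) :=
  (xi \o ract_lfun Z (a : A^c))%VF.

Lemma predual_actE (xi : 'Hom(Z, k^o)) (a : A) z :
  predual_act xi a z = xi (ract z (a : A^c)).
Proof. by rewrite comp_lfunE ract_lfunE. Qed.

(** The dual of an A^c-module, taken as a module over A rather than over the
    opposite of A^c. *)
Definition predual : rmod A.
Proof.
exists 'Hom(Z, k^o) predual_act => *; apply/lfunP => x;
  rewrite ?(add_lfunE, scale_lfunE, predual_actE) //.
- by rewrite ractDr linearD.
- by rewrite ractZr linearZ.
- by rewrite ract1.
- by rewrite -ractM.
Defined.

Lemma dual_predual_iso : ciso (C := rmod_cat A^c) (dual predual) Z.
Proof.
pose ev (z : Z) (xi : predual) : k^o := (xi : 'Hom(Z, k^o)) z.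
have ev_lin z : linear (ev z).
  by move=> c x y; rewrite /ev add_lfunE scale_lfunE.
pose evL z : {linear predual -> k^o} :=
  HB.pack (ev z) (GRing.isLinear.Build k _ _ _ _ (ev_lin z)).
have [c x y|z a|f fE] := @rhom_ofP _ _ Z (dual predual) (fun z => linfun (evL z)).
- apply/lfunP => xi; rewrite !(add_lfunE, scale_lfunE, lfunE) /= /ev.
  by rewrite linearP.
- apply/lfunP => xi; rewrite [RHS]dual_actE !lfunE /= /ev.
  by apply/esym/predual_actE.
have fxi z (xi : 'Hom(Z, k^o)) : (f z : 'Hom(predual, k^o)) xi = xi z.
  by rewrite fE lfunE.
apply/ciso_sym/(bij_ciso (f := f)) => [z1 z2 f12 | Psi].
  by apply: linear_form_sep_eq => xi; rewrite -!fxi f12.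
exists (\sum_(i < \dim {:Z})
  (Psi : 'Hom(predual, k^o)) (dual_basis i) *: (vbasis {:Z})`_i).
apply/lfunP => xi; rewrite fxi.
apply: (linear_form_reflexive (Psi := (Psi : 'Hom(predual, k^o)))).
exact: linearP.
Qed.

End Predual.

(** Transposition makes the modules over the opposite algebra the opposite of
    the category of modules. *)
Definition duality : equivalence (op_cat (rmod_cat A)) (rmod_cat A^c).
Proof.
apply: (@Equivalence (op_cat (rmod_cat A)) (rmod_cat A^c) dual
  (fun X Y (f : rhom Y X) => dual_hom f)).
- exact: dual_hom_id.
- by move=> X Y Z g f; apply: dual_hom_comp.
- by move=> X Y; apply: dual_hom0.
- by move=> X Y; apply: dual_hom_inj.
- by move=> X Y; apply: dual_hom_full.
- by move=> Z; exists (predual Z); apply: dual_predual_iso.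
Defined.

End Dual.

(** * Decompositions into indecomposable modules *)

Lemma finitely_many_finType (C : zcat) (Q : C -> Prop) (I : finType) (E : I -> C) :
  (forall X, Q X -> exists i, ciso X (E i)) -> finitely_many_up_to_ciso Q.
Proof.
move=> HE; exists #|I|, (fun i => E (enum_val i)) => X /HE[i Xi].
by exists (enum_rank i); rewrite enum_rankK.
Qed.

Section Decomposition.
Variables (k : fieldType) (A : falgType k).
Implicit Types (X Y Z K L M N : rmod A).
Local Notation mods := (rmod_cat A).
Local Notation cindec := (cindecomposable (C := mods)).

Definition rpow M (f : rhom M M) n : rhom M M := iter n (rcomp f) (rid M).

Lemma rpowS M (f : rhom M M) n : rpow f n.+1 = f \* rpow f n.
Proof. by []. Qed.

Lemma rpowD M (f : rhom M M) m n : rpow f (m + n)%N = rpow f m \* rpow f n.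
Proof. by elim: m => [|m IHm]; rewrite ?rcomp1l// addSn !rpowS -rcompA -IHm. Qed.

Lemma inj_endo_inv M (f : rhom M M) :
  injective f -> exists g, g \* f = rid M /\ f \* g = rid M.
Proof.
move=> f_inj; have /lker0P/lker0_limgf f_surj := f_inj.
have [|g fg] := lift_inj (f := rid M) f_inj.
  by move=> y; have [x <-] := proj1 (rhom_surjP f) f_surj y; exists x; rewrite ridE.
exists g; split=> //; apply: rhomP => x; apply: f_inj.
by rewrite rhomE -rcompE fg !ridE.
Qed.

(** Fitting's lemma: once the kernels of the powers of f have stopped growing,
    kernel and image of that power are complementary submodules. *)
Lemma fitting M (f : rhom M M) :
  indecomposable M -> (exists n, rpow f n = 0) \/ injective f.
Proof.
move=> [_ indM]; pose d n := \dim (lker (rpow f n)).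
have d_le n : (d n <= \dim {:M})%N by apply/dimvS/subvf.
have d_incr n : (d n <= d n.+1)%N.
  apply/dimvS/subvP => x; rewrite !memv_ker => /eqP x0.
  by rewrite rpowS rcompE x0 linear0.
have [n' n'_max] : exists n, forall m, (d m <= d n)%N.
  apply: NNPP => no_max.
  have grow j : exists n, (j <= d n)%N.
    elim: j => [|j [n jn]]; first by exists 0%N.
    apply: NNPP => no_n; case: no_max; exists n => m.
    rewrite leqNgt; apply/negP => dnm; case: no_n; exists m.
    exact: leq_ltn_trans jn dnm.
  by have [n] := grow (\dim {:M}).+1; rewrite ltnNge d_le.
pose n := n'.+1; have n_max m : (d m <= d n)%N := leq_trans (n'_max m) (d_incr n').
have ker_stable x : rpow f n (rpow f n x) = 0 -> rpow f n x = 0.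
  have sub : (lker (rpow f n) <= lker (rpow f (n + n)%N))%VS.
    by apply/subvP => y; rewrite !memv_ker rpowD rcompE => /eqP->; rewrite linear0.
  have geq_sub := geq_leqif (dimv_leqif_sup sub).
  have /subvP ker_sub : (lker (rpow f (n + n)%N) <= lker (rpow f n))%VS.
    by rewrite -geq_sub; apply: n_max.
  move=> x0; apply/eqP; rewrite -memv_ker; apply: ker_sub.
  by rewrite memv_ker rpowD rcompE x0.
have cap0 : (limg (rpow f n) :&: lker (rpow f n))%VS = 0%VS.
  apply/eqP; rewrite -subv0; apply/subvP => y /memv_capP[/memv_imgP[x _ ->]].
  by rewrite memv_ker memv0 => /eqP/ker_stable ->.
have full : (limg (rpow f n) + lker (rpow f n))%VS = fullv.
  apply/eqP; rewrite eqEdim subvf /= dimv_disjoint_sum// addnC.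
  by rewrite -(limg_ker_dim (rpow f n) fullv) capfv.
have [im0|ker0] := indM _ _ (@is_submod_limg _ _ _ _ _) (@is_submod_lker _ _ _ _ _) full cap0.
  left; exists n; apply: rhom0P => x; apply/eqP; rewrite -memv0 -im0.
  exact/memv_img/memvf.
right; apply: rhom_injP => x fx0; apply/eqP; rewrite -memv0 -ker0 memv_ker.
have f1 : rpow f 1 = f by apply: rcomp1.
by rewrite /n -addn1 rpowD rcompE f1 fx0 linear0.
Qed.

(** The endomorphism ring of an indecomposable module is local: dividing by f + g,
    assume that f + g = 1; if f is nilpotent, then an element killed by g is
    fixed by f, hence by all its powers, hence 0. *)
Lemma local_endomorphisms M (f g : rhom M M) : indecomposable M ->
  injective (f + g) -> injective f \/ injective g.
Proof.
move=> indM /inj_endo_inv[w [wfg _]].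
have [[n fn0] | wf_inj] := fitting (w \* f) indM; last first.
  by left=> x y fxy; apply: wf_inj; rewrite !rhomE fxy.
right; apply: rhom_injP => x gx0.
have fix_x : (w \* f) x = x.
  by rewrite -[in RHS](ridE x) -wfg rcompDr rhomDE [(w \* g) x]rhomE gx0 linear0 addr0.
have <- : rpow (w \* f) n x = x.
  elim: (n) => [|j IHj]; first exact: ridE.
  by rewrite rpowS rcompE IHj.
by rewrite fn0 rhomE.
Qed.

Lemma local_endomorphisms_sum M (I : finType) (f : I -> rhom M M) :
  indecomposable M -> injective (\sum_i f i) -> exists i, injective (f i).
Proof.
move=> indM; elim/big_rec: _ => [z_inj | i g _ IHg /(local_endomorphisms indM)[f_inj | //]].
  case: (indM) => nzM _; case: nzM; apply/is_zeroP => x.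
  by apply: z_inj; rewrite !rhomE.
by exists i.
Qed.

(** After correcting b so that b a = 1, the idempotent a b of L cannot be 0, so it
    is 1. *)
Lemma indecomposable_retract_iso M L (a : rhom M L) (b : rhom L M) :
  cindec M -> cindec L -> injective (b \* a) -> ciso (C := mods) M L.
Proof.
move=> [nzM _] [_ idemL] /inj_endo_inv[w [wba _]].
have {wba} ba : w \* b \* a = rid M by rewrite -rcompA.
have [||ab1] := idemL (a \* (w \* b)); last by exists a, (w \* b).
  by change (a \* (w \* b) \* (a \* (w \* b)) = a \* (w \* b));
     rewrite rcompA -(rcompA a) ba rcomp1.
move=> ab0; case: nzM; change (rid M = 0).
have -> : rid M = w \* b \* (a \* (w \* b)) \* a.
  by rewrite !rcompA ba rcomp1l ba.
by rewrite [a \* _]ab0 rcomp0 rcomp0l.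
Qed.

Lemma split_idempotent X (e : rhom X X) : e \* e = e ->
  exists Y (i : rhom Y X) (r : rhom X Y), r \* i = rid Y /\ i \* r = e.
Proof.
move=> ee; have [i [i_inj iP]] := sub_inclP (@is_submod_limg _ _ _ _ e).
have [|r rE] := lift_inj (f := e) i_inj.
  by move=> x; apply/iP/memv_img/memvf.
exists _, i, r; split=> //; apply: rhomP => y; apply: i_inj.
have /memv_imgP[x _ iy] : i y \in limg e by apply/iP; exists y.
by rewrite ridE rhomE -rcompE rE iy -rcompE ee.
Qed.

Lemma retract_dim X Y (i : rhom Y X) (r : rhom X Y) : r \* i = rid Y ->
  i \* r <> rid X -> (\dim {:Y} < \dim {:X})%N.
Proof.
move=> ri ir; have i_inj : injective i.
  by apply: (can_inj (g := r)) => y; rewrite -rcompE ri ridE.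
have dimY : \dim (limg i) = \dim {:Y}.
  by apply: limg_dim_eq; rewrite (proj2 (rhom_lker0P i) i_inj) capv0.
rewrite -dimY ltnNge; apply/negP => le_dim; case: ir.
have i_surj : rhom_surjective i by apply/eqP; rewrite eqEdim subvf.
apply: rhomP => x; have [y <-] := proj1 (rhom_surjP i) i_surj x.
by rewrite rcompE -[r (i y)]rcompE ri !ridE.
Qed.

Definition has_decomposition X :=
  exists (I : finType) (L : I -> rmod A)
    (u : forall j, rhom (L j) X) (v : forall j, rhom X (L j)),
    [/\ forall j, cindec (L j), forall j, v j \* u j = rid (L j)
      & \sum_j u j \* v j = rid X].

(** Decompositions are recorded by inclusions and projections rather than by
    direct sums, so they are transported by composing maps. *)
Lemma has_decomposition_sum X Y Z (i : rhom Y X) (r : rhom X Y)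
    (i' : rhom Z X) (r' : rhom X Z) :
    r \* i = rid Y -> r' \* i' = rid Z -> i \* r + i' \* r' = rid X ->
  has_decomposition Y -> has_decomposition Z -> has_decomposition X.
Proof.
move=> ri ri' sumX [I [L [u [v [indL vu sumY]]]]] [I' [L' [u' [v' [indL' vu' sumZ]]]]].
pose LL (j : I + I') := match j with inl j => L j | inr j => L' j end.
pose uu j : rhom (LL j) X := match j with inl j => i \* u j | inr j => i' \* u' j end.
pose vv j : rhom X (LL j) := match j with inl j => v j \* r | inr j => v' j \* r' end.
exists (I + I')%type, LL, uu, vv; split=> [[j|j]|[j|j]|] //=.
- by rewrite rcompA -(rcompA _ r) ri rcomp1.
- by rewrite rcompA -(rcompA _ r') ri' rcomp1.
rewrite big_sumType /= -sumX; congr (_ + _).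
  transitivity (i \* (\sum_j u j \* v j) \* r); last by rewrite sumY rcomp1.
  by rewrite rcomp_sumr rcomp_suml; apply: eq_bigr => j _; rewrite !rcompA.
transitivity (i' \* (\sum_j u' j \* v' j) \* r'); last by rewrite sumZ rcomp1.
by rewrite rcomp_sumr rcomp_suml; apply: eq_bigr => j _; rewrite !rcompA.
Qed.

Lemma decompositionP X : has_decomposition X.
Proof.
have [n] := ubnP (\dim {:X}); elim: n X => // n IHn X /ltnSE dimX.
have [id0 | nzX] := classic (rid X = 0).
  exists 'I_0, (fun=> X), (fun=> 0), (fun=> 0); split=> [[]|[]|] //.
  by rewrite big_ord0.
have [indX | not_indX] := classic (cindec X).
  exists unit, (fun=> X), (fun=> rid X), (fun=> rid X); split=> [||] //.
    by move=> _; rewrite rcomp1.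
  by rewrite (big_pred1 tt) ?rcomp1//; case.
have [e [ee [e0 e1]]] : exists e : rhom X X, e \* e = e /\ e <> 0 /\ e <> rid X.
  apply: NNPP => no_e; case: not_indX; split=> // e ee; apply: NNPP => ne.
  by case: no_e; exists e; split=> //; split=> He; case: ne; [left | right].
have [Y [i [r [ri ir]]]] := split_idempotent ee.
have [Z [i' [r' [ri' ir']]]] : exists Z (i' : rhom Z X) (r' : rhom X Z),
    r' \* i' = rid Z /\ i' \* r' = rid X - e.
  apply: split_idempotent; rewrite rcompDr rcompNr rcomp1 rcompDl rcompNl.
  by rewrite rcomp1l ee subrr subr0.
apply: (@has_decomposition_sum X Y Z i r i' r') => //.
- by rewrite ir ir' addrC subrK.
- by apply/IHn/(leq_trans (retract_dim ri _) dimX); rewrite ir.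
apply/IHn/(leq_trans (retract_dim ri' _) dimX); rewrite ir' => /eqP.
by rewrite subr_eq -subr_eq0 opprD addrA subrr sub0r oppr_eq0 => /eqP.
Qed.

(** The part of the Krull-Schmidt theorem that is used: up to isomorphism a
    module has finitely many indecomposable direct summands. *)
Lemma finitely_many_summands K : finitely_many_up_to_ciso (C := mods) (fun N =>
  cindec N /\ exists (a : rhom N K) (b : rhom K N), injective (b \* a)).
Proof.
have [I [L [u [v [indL vu sumK]]]]] := decompositionP K.
apply: (finitely_many_finType (C := mods) (E := L)) => N [indN [a [b ba_inj]]].
have [j fj_inj] : exists j, injective (b \* u j \* (v j \* a)).
  apply: local_endomorphisms_sum; first exact/indecomposableP.
  suff -> : \sum_j b \* u j \* (v j \* a) = b \* a by [].
  rewrite -[b in RHS]rcomp1 -sumK rcomp_sumr rcomp_suml.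
  by apply: eq_bigr => j _; rewrite !rcompA.
by exists j; apply: indecomposable_retract_iso fj_inj.
Qed.

End Decomposition.

(** * Modules over the endomorphism algebra of an additive generator *)

Section FinitenessUpToIso.
Variable C : zcat.
Implicit Type Q : C -> Prop.

Lemma finitely_many_sub Q Q' : (forall X, Q X -> Q' X) ->
  finitely_many_up_to_ciso Q' -> finitely_many_up_to_ciso Q.
Proof. by move=> QQ' [n [E HE]]; exists n, E => X /QQ'/HE. Qed.

Lemma finitely_many_union (I : finType) (Q : I -> C -> Prop) :
    (forall i, finitely_many_up_to_ciso (Q i)) ->
  finitely_many_up_to_ciso (fun X => exists i, Q i X).
Proof.
move=> /fin_all_exists[n /fin_all_exists[E HE]].
pose J : finType := {i : I & 'I_(n i)}.
apply: (finitely_many_finType (E := fun x : J => E (tag x) (tagged x))).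
by move=> X [i QX]; have [j Xij] := HE i X QX; exists (Tagged (fun i => 'I_(n i)) j).
Qed.

Lemma finitely_many_or Q Q' : finitely_many_up_to_ciso Q ->
  finitely_many_up_to_ciso Q' -> finitely_many_up_to_ciso (fun X => Q X \/ Q' X).
Proof.
move=> finQ finQ'; pose QQ (b : bool) := if b then Q else Q'.
apply: (@finitely_many_sub _ (fun X => exists b, QQ b X)) => [X [QX|QX]|].
- by exists true.
- by exists false.
by apply: finitely_many_union; case.
Qed.

End FinitenessUpToIso.

Section DirectPower.
Variables (k : fieldType) (A : falgType k) (M : rmod A) (n : nat).

Definition power_act (x : {ffun 'I_n -> M}) (a : A) : {ffun 'I_n -> M} :=
  [ffun i => ract (x i) a].

Definition power_rmod : rmod A.
Proof.
exists {ffun 'I_n -> M} power_act => *; apply/ffunP => i; rewrite !ffunE.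
- exact: ractDl.
- exact: ractDr.
- exact: ractZl.
- exact: ractZr.
- exact: ract1.
- exact: ractM.
Defined.

Lemma power_projectionP i : exists p : rhom power_rmod M,
  forall x : {ffun 'I_n -> M}, p x = x i.
Proof.
have [c x y|x a|p pE] :=
  @rhom_ofP _ _ power_rmod M (fun x => (x : {ffun 'I_n -> M}) i).
- by rewrite !ffunE.
- by rewrite ffunE.
by exists p.
Qed.

Lemma power_tupleP X (f : 'I_n -> rhom X M) : exists g : rhom X power_rmod,
  forall x, g x = [ffun i => f i x].
Proof.
have [c x y|x a|g gE] := @rhom_ofP _ _ X power_rmod (fun x => [ffun i => f i x]).
- by apply/ffunP => i; rewrite !ffunE linearP.
- by apply/ffunP => i; rewrite !ffunE rhomM.
by exists g.
Qed.

End DirectPower.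

Definition additive_generator (k : fieldType) (B : falgType k) (M : rmod B) : Prop :=
  forall X : rmod B, exists n (s : 'I_n -> rhom M X) (r : 'I_n -> rhom X M),
    \sum_j s j \* r j = rid X.

(** As in is_end_algebra, the product of the algebra corresponds to the composition
    (f g)(x) = f (g x), so that Hom(M, X) is a right module over it. *)
Record endomorphism_iso (k : fieldType) (B C : falgType k) (M : rmod B) := EndoIso {
  endo :> C -> rhom M M;
  endo_linear : linear endo;
  endo1 : endo 1 = rid M;
  endoM : forall a b, endo (a * b) = endo a \* endo b;
  endo_inj : injective endo;
  endo_surj : forall g, exists c, endo c = g
}.

Section EndomorphismAlgebra.
Variables (k : fieldType) (B C : falgType k) (M : rmod B).
Variable psi : endomorphism_iso C M.
Hypothesis genM : additive_generator M.
Implicit Types (X Y Z : rmod B) (N P F : rmod C).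
Local Notation mods := (rmod_cat C).

Lemma endoD a b : psi (a + b) = psi a + psi b.
Proof. by have := endo_linear psi 1 a b; rewrite !scale1r. Qed.

Lemma endoZ c a : psi (c *: a) = c *: psi a.
Proof.
have psi0 : psi 0 = 0.
  by have := endo_linear psi (-1) 0 0; rewrite scaler0 addr0 scaleN1r addNr.
by have := endo_linear psi c a 0; rewrite psi0 !addr0.
Qed.

Definition endo_inv (g : rhom M M) : C :=
  proj1_sig (constructive_indefinite_description _ (endo_surj psi g)).

Lemma endo_invK g : psi (endo_inv g) = g.
Proof. by rewrite /endo_inv; case: constructive_indefinite_description. Qed.

Lemma endo_inv_linear : linear endo_inv.
Proof.
move=> c f g; apply: (endo_inj (e := psi)).
by rewrite endoD endoZ !endo_invK.
Qed.

Definition hom_act X (g : rhom M X) (c : C) : rhom M X := g \* psi c.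

Definition hom_rmod X : rmod C.
Proof.
exists (rhom M X) (@hom_act X) => *; rewrite /hom_act.
- by rewrite rcompDl.
- by rewrite endoD rcompDr.
- by apply: rhomP => x; rewrite !rhomE.
- by rewrite endoZ; apply: rhomP => x; rewrite !rhomE linearZ.
- by rewrite endo1 rcomp1.
- by rewrite endoM rcompA.
Defined.

Arguments hom_rmod : simpl never.

Lemma hom_ractE X (g : rhom M X) (c : C) : ract (g : hom_rmod X) c = g \* psi c.
Proof. by []. Qed.

Fact hom_map_sig X Y (f : rhom X Y) :
  {g : rhom (hom_rmod X) (hom_rmod Y) | forall h : rhom M X, g h = f \* h}.
Proof.
apply: rhom_ofP => [c h1 h2 | h c]; last by rewrite !hom_ractE rcompA.
by apply: rhomP => x; rewrite !rhomE linearP.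
Qed.

Definition hom_map X Y (f : rhom X Y) : rhom (hom_rmod X) (hom_rmod Y) :=
  proj1_sig (hom_map_sig f).

Lemma hom_mapE X Y (f : rhom X Y) (h : rhom M X) : hom_map f h = f \* h.
Proof. by rewrite /hom_map; case: hom_map_sig. Qed.

Lemma hom_map_comp X Y Z (g : rhom Y Z) (f : rhom X Y) :
  hom_map (g \* f) = hom_map g \* hom_map f.
Proof. by apply: rhomP => h; rewrite rcompE !hom_mapE rcompA. Qed.

Lemma hom_map_id X : hom_map (rid X) = rid (hom_rmod X).
Proof. by apply: rhomP => h; rewrite hom_mapE rcomp1l ridE. Qed.

Lemma hom_mapD X Y (f g : rhom X Y) : hom_map (f + g) = hom_map f + hom_map g.
Proof. by apply: rhomP => h; rewrite rhomDE !hom_mapE rcompDl. Qed.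

Lemma hom_mapN X Y (f : rhom X Y) : hom_map (- f) = - hom_map f.
Proof. by apply: rhomP => h; rewrite rhomNE !hom_mapE rcompNl. Qed.

Lemma hom_map0 X Y : hom_map (0 : rhom X Y) = 0.
Proof. by apply: rhomP => h; rewrite hom_mapE rcomp0l rhomE. Qed.

Lemma hom_map_inj X Y : injective (@hom_map X Y).
Proof.
move=> f g fg; have [n [s [r sr]]] := genM X.
rewrite -[f]rcomp1 -[g]rcomp1 -sr !rcomp_sumr; apply: eq_bigr => j _.
by rewrite !rcompA -!hom_mapE fg.
Qed.

(** If the identity of X is the sum of the s j r j, then every h from M to X is
    the sum of the s j (r j h) with r j h in the algebra, so that a homomorphism
    out of Hom(M, X) is determined by its values at the s j. This makes
    Hom(M, -) full, and Hom(M, X) projective. *)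
Lemma hom_rmod_expand X n (s : 'I_n -> rhom M X) (r : 'I_n -> rhom X M) :
  \sum_j s j \* r j = rid X ->
  forall h : hom_rmod X, h = \sum_j ract (s j : hom_rmod X) (endo_inv (r j \* h)).
Proof.
move=> sr h; rewrite -[LHS]rcomp1l -sr rcomp_suml; apply: eq_bigr => j _.
by rewrite hom_ractE endo_invK rcompA.
Qed.

Lemma hom_map_full X Y (g : rhom (hom_rmod X) (hom_rmod Y)) :
  exists f, hom_map f = g.
Proof.
have [n [s [r sr]]] := genM X; exists (\sum_j (g (s j) : rhom M Y) \* r j).
apply: rhomP => h; rewrite hom_mapE rcomp_suml.
rewrite [in RHS](hom_rmod_expand sr h) linear_sum; apply: eq_bigr => j _.
by rewrite [RHS](rhomM g) hom_ractE endo_invK rcompA.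
Qed.

Lemma hom_rmod_projective X : cprojective (C := mods) (hom_rmod X).
Proof.
move=> E G p g /epi_surjP p_surj; have [n [s [r sr]]] := genM X.
have /fin_all_exists[e eE] j : exists e, p e = g (s j) by apply: p_surj.
have [c h1 h2|h c|f fE] := @rhom_ofP _ _ (hom_rmod X) E
  (fun h => \sum_j ract (e j) (endo_inv (r j \* h))).
- rewrite scaler_sumr -big_split; apply: eq_bigr => j _ /=.
  by rewrite -ractZr -ractDr -endo_inv_linear; congr (ract _ (endo_inv _));
     apply: rhomP => x; rewrite !rhomE linearP.
- rewrite ract_sum; apply: eq_bigr => j _; rewrite -ractM; congr (ract _ _).
  by apply: (endo_inj (e := psi)); rewrite endoM !endo_invK hom_ractE rcompA.
exists f; change (p \* f = g); apply: rhomP => h; rewrite rhomE fE linear_sum.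
rewrite [in RHS](hom_rmod_expand sr h) linear_sum; apply: eq_bigr => j _.
by rewrite [LHS](rhomM p) [RHS](rhomM g) eE.
Qed.

(** Hom(M, M) is the regular module, so Hom(M, M ^ d) is free of rank d; it maps
    onto N by sending its d generators to a k-basis of N. *)
Lemma hom_rmod_cover N : exists X (p : rhom (hom_rmod X) N), forall y, exists x, p x = y.
Proof.
pose X := power_rmod M (\dim {:N}); exists X.
have /fin_all_exists[pr prE] := @power_projectionP _ _ M (\dim {:N}).
have [c h1 h2|h c|p pE] := @rhom_ofP _ _ (hom_rmod X) N
  (fun h => \sum_(j < \dim {:N}) ract (vbasis {:N})`_j (endo_inv (pr j \* h))).
- rewrite scaler_sumr -big_split; apply: eq_bigr => j _ /=.
  by rewrite -ractZr -ractDr -endo_inv_linear; congr (ract _ (endo_inv _));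
     apply: rhomP => x; rewrite !rhomE linearP.
- rewrite ract_sum; apply: eq_bigr => j _; rewrite -ractM; congr (ract _ _).
  by apply: (endo_inj (e := psi)); rewrite endoM !endo_invK hom_ractE rcompA.
exists p => y.
(* The components of h are the coordinates of y, as multiples of the identity. *)
have [h hE] := power_tupleP (fun j => coord (vbasis {:N}) j y *: rid M).
exists h; rewrite pE [RHS](coord_vbasis (memvf y)); apply: eq_bigr => j _.
rewrite -[in RHS](ract1 (vbasis {:N})`_j) -ractZr; congr (ract _ _).
apply: (endo_inj (e := psi)); rewrite endo_invK endoZ endo1.
by apply: rhomP => x; rewrite rcompE prE hE ffunE.
Qed.

(** A projective module is the image of an idempotent of a free module Hom(M, X);
    that idempotent comes from one of X, because Hom(M, -) is fully faithful,
    and idempotents split in the category of B-modules. *)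
Lemma projective_hom_rmod P :
  cprojective (C := mods) P -> exists X, ciso (C := mods) (hom_rmod X) P.
Proof.
move=> prP; have [X [p p_surj]] := hom_rmod_cover P.
have [s ps] := prP _ _ p (rid P) (proj2 (epi_surjP p) p_surj).
change (p \* s = rid P) in ps.
have [e eE] := hom_map_full (s \* p).
have ee : e \* e = e.
  by apply: hom_map_inj; rewrite hom_map_comp eE rcompA -(rcompA s) ps rcomp1.
have [Y [i [r [ri ir]]]] := split_idempotent ee.
exists Y, (p \* hom_map i), (hom_map r \* s); split.
  change (hom_map r \* s \* (p \* hom_map i) = rid (hom_rmod Y)).
  rewrite rcompA -(rcompA _ s) -eE -!hom_map_comp -ir rcompA ri rcomp1l ri.
  exact: hom_map_id.
change (p \* hom_map i \* (hom_map r \* s) = rid P).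
by rewrite rcompA -(rcompA p) -hom_map_comp ir eE !rcompA ps rcomp1l ps.
Qed.

(** Injectivity of f is where faithfulness enters: Hom(M, -) reflects
    monomorphisms. *)
Lemma hom_short_resolution N : has_short_resolution (C := mods) N ->
  exists X Y (f : rhom X Y) (p : rhom (hom_rmod Y) N),
    [/\ injective f, forall z, exists y, p y = z
      & forall y, p y = 0 <-> exists x, y = hom_map f x].
Proof.
case=> P1 [P0 [i [p [pr1 pr0 /epi_surjP p_surj /is_ckernelP[i_inj ip]]]]].
have [X [a [a' [a'a aa']]]] := projective_hom_rmod pr1.
have [Y [b [b' [b'b bb']]]] := projective_hom_rmod pr0.
have aK y : a (a' y) = y by rewrite -rcompE [a \* a']aa' ridE.
have bK y : b (b' y) = y by rewrite -rcompE [b \* b']bb' ridE.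
have b'K y : b' (b y) = y by rewrite -rcompE [b' \* b]b'b ridE.
have a'K y : a' (a y) = y by rewrite -rcompE [a' \* a]a'a ridE.
have [f fE] := hom_map_full (b' \* i \* a).
have fE' x : hom_map f x = b' (i (a x)) by rewrite fE !rcompE.
exists X, Y, f, (p \* b); split=> [|z|y].
- apply/mono_injP => W u v; change (f \* u = f \* v -> u = v) => uv.
  apply: hom_map_inj; apply: rhomP => w.
  apply: (can_inj a'K); apply: i_inj; apply: (can_inj bK).
  by rewrite -!fE' -!rcompE -!hom_map_comp uv.
- by have [y <-] := p_surj z; exists (b' y); rewrite rcompE bK.
rewrite rcompE ip; split=> [[x bx] | [x ->]].
  by exists (a' x); rewrite fE' aK -bx b'K.
by exists (a x); rewrite fE' bK.
Qed.

(** With 0 -> Hom(M, X) -> Hom(M, Y) -> N -> 0, where X is a submodule of Y and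
    Z = Y / X, left exactness of Hom(M, -) embeds N in Hom(M, Z), with cokernel
    F = coker (Hom(M, Y) -> Hom(M, Z)). If 0 -> Hom(M, X') -> Hom(M, Y') -> F' -> 0
    for a direct summand F' of F, then lifting the inclusion and the projection
    to Y' -> Z -> Y' writes the identity of Y' as a sum of two maps into X',
    because Y -> Z is onto; so X' = Y' and F' = 0. *)
Lemma embed_in_projective N : has_short_resolution (C := mods) N ->
  exists Z F (j : rhom N (hom_rmod Z)) (q : rhom (hom_rmod Z) F),
    [/\ injective j, forall y, exists x, q x = y,
        forall y, q y = 0 <-> exists x, y = j x
      & forall F' (u : rhom F' F) (v : rhom F F'), v \* u = rid F' ->
          has_short_resolution (C := mods) F' -> rid F' = 0].
Proof.
move=> /hom_short_resolution[X [Y [f [p [f_inj p_surj p_ker]]]]].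
have [Z [pi [pi_surj pi_ker]]] := cokernelP f.
have pif : pi \* f = 0 by apply: rhom0P => x; rewrite rcompE; apply/pi_ker; exists x.
have [|j jE] := descend_surj (f := hom_map pi) p_surj.
  by move=> y /p_ker[x ->]; rewrite -rcompE -hom_map_comp pif hom_map0 rhomE.
(* Left exactness: a map from M to Y that vanishes in Z factors through f. *)
have j_inj : injective j.
  apply: rhom_injP => z; have [y <-] := p_surj z; rewrite -rcompE jE hom_mapE => piy.
  have [|h hE] := lift_inj (f := y : rhom M Y) f_inj.
    by move=> m; apply/pi_ker; rewrite -rcompE piy rhomE.
  by apply/p_ker; exists h; rewrite hom_mapE.
have [F [q [q_surj q_ker]]] := cokernelP j.
have qj : q \* j = 0 by apply: rhom0P => x; rewrite rcompE; apply/q_ker; exists x.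
exists Z, F, j, q; split=> //; first by move=> y; have [x ->] := q_surj y; exists x.
move=> F' u v vu /hom_short_resolution[X' [Y' [f' [p' [f'_inj p'_surj p'_ker]]]]].
have q_epi : epi (C := mods) q.
  by apply/epi_surjP => y; have [x ->] := q_surj y; exists x.
have p'_epi : epi (C := mods) p' by apply/epi_surjP.
have [a' a'E] := @hom_rmod_projective Y' _ _ q (u \* p') q_epi.
have [b' b'E] := @hom_rmod_projective Z _ _ p' (v \* q) p'_epi.
change (q \* a' = u \* p') in a'E; change (p' \* b' = v \* q) in b'E.
have [a aE] := hom_map_full a'; have [b bE] := hom_map_full b'.
have factor W (g : rhom W Y') : p' \* hom_map g = 0 -> exists h, g = f' \* h.
  move=> pg; have f'M_inj : injective (hom_map f').
    apply: rhom_injP => h; rewrite hom_mapE => fh; apply: rhomP => m.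
    by apply: f'_inj; rewrite -rcompE fh !rhomE linear0.
  have [|h hE] := lift_inj (f := hom_map g) f'M_inj.
    by move=> w; apply/p'_ker; rewrite -rcompE pg rhomE.
  have [h' h'E] := hom_map_full h; exists h'.
  by apply: hom_map_inj; rewrite hom_map_comp h'E hE.
(* b a lifts v u = 1 along p', so it differs from 1 by a map into the kernel of
   p', which is the image of f'. *)
have [c cE] : exists c, rid Y' - b \* a = f' \* c.
  apply: factor; rewrite hom_mapD hom_mapN hom_map_comp hom_map_id aE bE.
  by rewrite rcompDr rcompNr rcomp1 rcompA b'E -rcompA a'E rcompA vu rcomp1l subrr.
have [d dE] : exists d, b \* pi = f' \* d.
  apply: factor; rewrite hom_map_comp bE rcompA b'E -rcompA -jE (rcompA q).
  by rewrite qj rcomp0l rcomp0.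
(* y = b (a y) + f' (c y), and b (a y) = b (pi w) = f' (d w) if a y = pi w. *)
have f'_surj y : exists x, y = f' x.
  have [w aw] := pi_surj (a y); exists (c y + d w).
  by rewrite linearD /= -!rcompE -cE -dE !rhomE -aw subrK.
apply: rhom0P => z; rewrite ridE; have [y <-] := p'_surj z; apply/p'_ker.
have [h hE] := lift_inj (f := y : rhom M Y') f'_inj (fun m => f'_surj _).
by exists h; rewrite hom_mapE.
Qed.

Lemma cprojective_retract N P (a : rhom N P) (b : rhom P N) :
  b \* a = rid N -> cprojective (C := mods) P -> cprojective (C := mods) N.
Proof.
move=> ba prP Y Z p g p_epi; have [h hE] := prP _ _ p (g \* b) p_epi.
exists (h \* a); change (p \* (h \* a) = g).
by rewrite rcompA [p \* h]hE -rcompA ba rcomp1.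
Qed.

(** The indecomposable summands of the cokernel F of N in Hom(M, Z) are among
    the finitely many modules E i whose projective dimension is not 1. Lifting
    the identity of F through surjections from projective modules onto the E i
    writes the identity of N as a sum of endomorphisms that factor through the
    kernels K i of these, plus one that factors through Hom(M, Z). As N is not
    projective and its endomorphism ring is local, it is a direct summand of
    some K i. *)
Lemma glued_rep_finite : cright_glued mods -> crep_finite mods.
Proof.
move=> glued; have [n [E HE]] := glued.
have coverE i : exists K X (q : rhom (hom_rmod X) (E i)) (l : rhom K (hom_rmod X)),
    [/\ forall y, exists x, q x = y, injective l
      & forall x, q x = 0 <-> exists y, x = l y].
  have [X [q q_surj]] := hom_rmod_cover (E i).
  by have [K [l [l_inj lP]]] := kernelP q; exists K, X, q, l.
have /fin_all_exists[K KP] := coverE.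
apply: (finitely_many_sub _ (finitely_many_or glued
  (finitely_many_union (fun i => finitely_many_summands (K i))))) => N indN.
have [pdN | npdN] := classic (cpd_one (C := mods) N); [right | by left].
have [resN nprN] := pdN.
have [Z [F [j [q [j_inj q_surj q_ker summands0]]]]] := embed_in_projective resN.
have prZ := @hom_rmod_projective Z.
have qj : q \* j = 0 by apply: rhom0P => x; rewrite rcompE; apply/q_ker; exists x.
have [I [L [u [v [indL vu sumF]]]]] := decompositionP F.
(* tg.1 lifts the projection of F to its summand L l, and tg.2 is the map that
   it induces on N; tg.1 factors through the projective module over E i. *)
have lifts l : exists tg : rhom (hom_rmod Z) (hom_rmod Z) * rhom N N,
    [/\ q \* tg.1 = u l \* v l \* q, tg.1 \* j = j \* tg.2
      & exists i (a : rhom N (K i)) (b : rhom (K i) N), tg.2 = b \* a].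
  have [|i [w [w' [w'w ww']]]] := HE (L l).
    split=> [//|[resL _]]; case: (indL l) => nzL _; case: nzL.
    exact: (summands0 _ (u l) (v l)).
  have [X [r [m [r_surj m_inj m_ker]]]] := KP i.
  have rm : r \* m = 0 by apply: rhom0P => x; rewrite rcompE; apply/m_ker; exists x.
  have [b bE] := prZ _ _ r (w \* v l \* q) (proj2 (epi_surjP r) r_surj).
  have [a aE] := @hom_rmod_projective X _ _ q (u l \* w' \* r) (proj2 (epi_surjP q) q_surj).
  change (r \* b = w \* v l \* q) in bE; change (q \* a = u l \* w' \* r) in aE.
  change (w' \* w = rid (L l)) in w'w.
  have [|b0 b0E] := lift_inj (f := b \* j) m_inj.
    move=> x; apply/m_ker; rewrite -rcompE rcompA bE -rcompA qj.
    by rewrite rcomp0 rhomE.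
  have [|a0 a0E] := lift_inj (f := a \* m) j_inj.
    move=> x; apply/q_ker; rewrite -rcompE rcompA aE -rcompA rm.
    by rewrite rcomp0 rhomE.
  exists (a \* b, a0 \* b0); split=> /=; last by exists i, b0, a0.
    by rewrite rcompA aE -rcompA bE !rcompA -(rcompA _ w') w'w rcomp1.
  by rewrite -rcompA -b0E !rcompA a0E.
have /fin_all_exists[tg tgP] := lifts.
pose t := \sum_l (tg l).1; pose g := \sum_l (tg l).2.
have qt : q \* t = q.
  rewrite -[RHS]rcomp1l -sumF rcomp_sumr rcomp_suml.
  by apply: eq_bigr => l _; have [] := tgP l.
have tj : t \* j = j \* g.
  by rewrite rcomp_sumr rcomp_suml; apply: eq_bigr => l _; have [] := tgP l.
(* t lifts the identity of F, so 1 - t has its values in the image of j. *)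
have [|h hE] := lift_inj (f := rid _ - t) j_inj.
  move=> x; apply/q_ker.
  by rewrite -rcompE rcompDr rcompNr rcomp1 qt subrr rhomE.
have sumN : g + h \* j = rid N.
  apply: rhomP => x; apply: j_inj; rewrite -!rcompE rcompDr rcompA hE -tj.
  by rewrite rcompDl rcompNl rcomp1l addrC subrK rcomp1.
have indN' : indecomposable N by apply/indecomposableP.
have [||i] := local_endomorphisms (f := g) (g := h \* j) indN'.
- by rewrite sumN => x y; rewrite !ridE.
- move=> g_inj; have [l gl_inj] := local_endomorphisms_sum indN' g_inj.
  have [_ _ [i [a [b ab]]]] := tgP l.
  by exists i; split=> //; exists a, b; rewrite -ab.
move/inj_endo_inv: i => [w [whj _]]; case: nprN.
by apply: (@cprojective_retract _ _ j (w \* h)) => //; rewrite -rcompA.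
Qed.

End EndomorphismAlgebra.

(** * Auslander algebras *)

Section Morita.
Variables (k : fieldType) (A C : falgType k).

Definition functor_map (F : rfunctor A C) (X Y : rmod A) (f : rhom X Y) :
  rhom (F X) (F Y) := mk_rhom (@fmap_hom _ _ _ F _ _ _ (is_rhom_rhom f)).

Lemma functor_map_comp (F : rfunctor A C) X Y Z (g : rhom Y Z) (f : rhom X Y) :
  functor_map F (g \* f) = functor_map F g \* functor_map F f.
Proof. by apply/val_inj/fmap_comp; apply: is_rhom_rhom. Qed.

Lemma functor_map_id (F : rfunctor A C) X : functor_map F (rid X) = rid (F X).
Proof. exact/val_inj/fmap_id. Qed.

(** Zero is the combination (-1) 0 + 0, which a linear functor sends to
    - F 0 + F 0. *)
Lemma functor_map0 (F : rfunctor A C) X Y : functor_map F (0 : rhom X Y) = 0.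
Proof.
have f0 : is_rhom (0 : 'Hom(X, Y)) by move=> x a; rewrite !zero_lfunE ract0.
have := @fmap_linear _ _ _ F _ _ (-1) _ _ f0 f0; rewrite scaler0 addr0 scaleN1r addNr => F0.
exact: val_inj.
Qed.

End Morita.

Lemma natiso_id_faithful (k : fieldType) (A C : falgType k)
    (F : rfunctor A C) (G : rfunctor C A) (X Y : rmod A) :
  comp_natiso_id F G -> injective (@functor_map k A C F X Y).
Proof.
case=> eta [eta_iso eta_nat] f g fg; apply: rhomP => x.
have [Heta eta_inj _] := eta_iso Y.
have eta_injP : injective (mk_rhom Heta) by apply/rhom_lker0P.
apply: eta_injP; rewrite !mk_rhomE -!comp_lfunE !eta_nat; try exact: is_rhom_rhom.
by congr ((fmap G _ \o _)%VF x); have := congr1 (@rhom_lfun _ _ _ _) fg.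
Qed.

Lemma natiso_id_ciso (k : fieldType) (A C : falgType k)
    (F : rfunctor A C) (G : rfunctor C A) (X : rmod A) :
  comp_natiso_id F G -> ciso (C := rmod_cat A) (G (F X)) X.
Proof.
case=> eta [eta_iso _]; apply/ciso_sym/isomorphicP.
by exists (eta X).
Qed.

(** The preimage of h is G h conjugated by the unit; it is one because G is
    faithful by the other isomorphism. *)
Lemma natiso_id_full (k : fieldType) (A C : falgType k)
    (F : rfunctor A C) (G : rfunctor C A) (X Y : rmod A) (h : rhom (F X) (F Y)) :
    comp_natiso_id F G -> comp_natiso_id G F ->
  exists f : rhom X Y, functor_map F f = h.
Proof.
move=> eta_id eps_id; have [eta [eta_iso eta_nat]] := eta_id.
have [HX eX_inj eX_surj] := eta_iso X; have [HY eY_inj eY_surj] := eta_iso Y.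
pose eX : rhom X (G (F X)) := mk_rhom HX; pose eY : rhom Y (G (F Y)) := mk_rhom HY.
have eX_epi : epi (C := rmod_cat A) eX by apply/epi_surjP/rhom_surjP.
have [||f fE] := lift_inj (i := eY) (f := functor_map G h \* eX).
- exact/rhom_lker0P.
- move=> x; have [y <-] := proj1 (rhom_surjP eY) eY_surj ((functor_map G h \* eX) x).
  by exists y.
exists f; apply: (natiso_id_faithful eps_id); apply: eX_epi.
change (functor_map G (functor_map F f) \* eX = functor_map G h \* eX).
rewrite -fE; apply: val_inj => /=; rewrite -eta_nat//.
exact: is_rhom_rhom.
Qed.

Lemma morita_equivalence (k : fieldType) (A C : falgType k) :
  morita_equivalent A C -> inhabited (equivalence (rmod_cat A) (rmod_cat C)).
Proof.
case=> F [G [eta_id eps_id]]; constructor.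
apply: (@Equivalence (rmod_cat A) (rmod_cat C) F (@functor_map k A C F)).
- exact: functor_map_id.
- exact: functor_map_comp.
- exact: functor_map0.
- by move=> X Y; apply: (natiso_id_faithful eta_id).
- by move=> X Y h; apply: natiso_id_full eta_id eps_id.
by move=> Y; exists (G Y); apply: natiso_id_ciso.
Qed.

Section EndAlgebra.
Variables (k : fieldType) (B C : falgType k).

Lemma is_end_algebra_iso (M : rmod B) :
  is_end_algebra C M -> inhabited (endomorphism_iso C M).
Proof.
case=> phi [phi_inj phi_im phi1 phiM].
have phi_rhom c : is_rhom (phi c) by apply/phi_im/memv_img/memvf.
constructor; apply: (@EndoIso k B C M (fun c => mk_rhom (phi_rhom c))).
- by move=> a x y; apply: val_inj; rewrite /= linearP.
- exact: val_inj.
- by move=> a b; apply: val_inj; rewrite /= phiM.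
- by move=> a b /(congr1 val)/=; apply/lker0P/eqP.
move=> g; have /phi_im/memv_imgP[c _ gE] := is_rhom_rhom g.
by exists c; apply: val_inj.
Qed.

Definition is_retract (X Y : rmod B) :=
  exists (i : rhom X Y) (r : rhom Y X), r \* i = rid X.

Lemma is_retract_dsum (X Y Z : rmod B) :
  is_retract X Y \/ is_retract X Z -> is_retract X (dsum Y Z).
Proof.
have [c [] ? ? [] ? ?|[] ? ? a|pY pYE] := @rhom_ofP _ _ (dsum Y Z) Y fst => //.
have [c [] ? ? [] ? ?|[] ? ? a|pZ pZE] := @rhom_ofP _ _ (dsum Y Z) Z snd => //.
have [c x y|x a|iY iYE] := @rhom_ofP _ _ Y (dsum Y Z) (fun y => (y, 0)).
- by congr pair; rewrite /= scaler0 addr0.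
- by congr pair; rewrite /= ract0.
have [c x y|x a|iZ iZE] := @rhom_ofP _ _ Z (dsum Y Z) (fun z => (0, z)).
- by congr pair; rewrite /= scaler0 addr0.
- by congr pair; rewrite /= ract0.
have pYiY : pY \* iY = rid Y by apply: rhomP => y; rewrite !rhomE pYE iYE.
have pZiZ : pZ \* iZ = rid Z by apply: rhomP => z; rewrite !rhomE pZE iZE.
case=> -[i [r ri]].
  by exists (iY \* i), (r \* pY); rewrite rcompA -(rcompA r) pYiY rcomp1.
by exists (iZ \* i), (r \* pZ); rewrite rcompA -(rcompA r) pZiZ rcomp1.
Qed.

Lemma is_retract_bigdsum n (M : 'I_n -> rmod B) i : is_retract (M i) (bigdsum M).
Proof.
rewrite /bigdsum; have : i \in index_enum 'I_n by apply: mem_index_enum.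
elim: (index_enum _) => // j r IHr; rewrite inE big_cons => ij.
apply: is_retract_dsum; case/orP: ij => [/eqP <- | /IHr]; last by right.
by left; exists (rid _), (rid _); rewrite rcomp1.
Qed.

(** Every indecomposable summand of X is isomorphic to some M i, hence a direct
    summand of the sum of all of them. *)
Lemma complete_additive_generator n (M : 'I_n -> rmod B) :
  complete_indecomposables M -> additive_generator (bigdsum M).
Proof.
move=> [_ _ allM] X; have [I [L [u [v [indL _ sumX]]]]] := decompositionP X.
have factor l : exists sr : rhom (bigdsum M) (L l) * rhom (L l) (bigdsum M),
    sr.1 \* sr.2 = rid (L l).
  have [i /isomorphicP[f [g [gf _]]]] := allM _ (proj2 (indecomposableP _) (indL l)).
  have [s [r rs]] := is_retract_bigdsum M i; exists (g \* r, s \* f).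
  by rewrite /= rcompA -(rcompA g) rs rcomp1.
have /fin_all_exists[sr srE] := factor.
exists #|I|, (fun j => u (enum_val j) \* (sr (enum_val j)).1),
  (fun j => (sr (enum_val j)).2 \* v (enum_val j)).
rewrite -sumX (reindex (@enum_val I I)) /=; last first.
  by exists enum_rank => j _; rewrite ?enum_valK ?enum_rankK.
by apply: eq_bigr => j _; rewrite rcompA -(rcompA (u _)) srE rcomp1.
Qed.

(** Transposition reverses composition, as does the product of the opposite
    algebra. *)
Lemma dual_endomorphism_iso (M : rmod B) :
  endomorphism_iso C M -> endomorphism_iso C^c (dual M).
Proof.
move=> psi; apply: (@EndoIso k B^c C^c (dual M) (fun c => dual_hom (psi c))).
- by move=> c a b; rewrite -dual_hom_linear; congr dual_hom; apply: endo_linear.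
- by rewrite -dual_hom_id; congr dual_hom; apply: endo1.
- by move=> a b; rewrite -dual_hom_comp -endoM.
- by move=> a b /dual_hom_inj/endo_inj.
move=> g; have [f <-] := dual_hom_full g; have [c <-] := endo_surj psi f.
by exists c.
Qed.

Lemma dual_additive_generator (M : rmod B) :
  additive_generator M -> additive_generator (dual M).
Proof.
move=> genM Z; have [a [b [ba ab]]] := dual_predual_iso Z.
have [n [s [r sr]]] := genM (predual Z).
exists n, (fun j => a \* dual_hom (r j)), (fun j => dual_hom (s j) \* b).
transitivity (a \* (\sum_j dual_hom (r j) \* dual_hom (s j)) \* b).
  by rewrite rcomp_sumr rcomp_suml; apply: eq_bigr => j _; rewrite !rcompA.
suff -> : \sum_j dual_hom (r j) \* dual_hom (s j) = rid _ by rewrite rcomp1.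
rewrite -dual_hom_id -sr.
have dual_homD (f g : rhom (predual Z) (predual Z)) :
    dual_hom (f + g) = dual_hom f + dual_hom g.
  by rewrite -[f]scale1r dual_hom_linear !scale1r.
rewrite (big_morph _ dual_homD (dual_hom0 _ _)).
by apply: eq_bigr => j _; rewrite dual_hom_comp.
Qed.

End EndAlgebra.

Theorem theorem1p2 (k : closedFieldType) (A : falgType k) :
  is_auslander_algebra A -> (left_glued A \/ right_glued A) <-> rep_finite A.
Proof.
move=> [B [C [[n [M [complM endC]]] /morita_equivalence[E]]]].
have genM := complete_additive_generator complM.
have [psi] := is_end_algebra_iso endC.
split=> [[gluedA | gluedA] | [m [L HL]]].
- apply/crep_finite_rep_finite/op_rep_finite.
  apply/(equivalence_rep_finite (op_equivalence E)).
  apply/(equivalence_rep_finite (duality C)).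
  apply: (glued_rep_finite (dual_endomorphism_iso psi) (dual_additive_generator genM)).
  apply/(equivalence_right_glued (duality C)).
  apply/(equivalence_right_glued (op_equivalence E)).
  exact: left_glued_cright_glued.
- apply/crep_finite_rep_finite/(equivalence_rep_finite E).
  apply: (glued_rep_finite psi genM).
  exact/(equivalence_right_glued E)/right_glued_cright_glued.
by left; exists m, L => X [/HL].
Qed.
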